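(* Let $0\le a_1\le a$ be integers and let $\alpha,\beta,\gamma,\delta,\epsilon,\zeta\in\binom{[a]}{a_1}$ (i.e. $\mathrm{sort}(\alpha)=\mathrm{sort}(\beta)=\mathrm{sort}(\gamma)=\mathrm{sort}(\delta)=\mathrm{sort}(\epsilon)=\mathrm{sort}(\zeta)$). Then $$\mathrm{Hex}(\alpha,\beta,\gamma,\delta,\epsilon,\zeta)=\mathrm{Hex}(f(\alpha),f(\beta),f(\gamma),f(\delta),f(\epsilon),f(\zeta))$$ for any bijection $f:\{\alpha,\beta,\gamma,\delta,\epsilon,\zeta\}\to\{\alpha,\beta,\gamma,\delta,\epsilon,\zeta\}$ (the labels being regarded as formal symbols). In other words, all the boundary labels can be permuted freely while preserving the number of hexagonal puzzles.
   Context: Strings: $\binom{[n]}{k}$ denotes the set of binary strings (words in the symbols $0,1$) of length $n$ with exactly $k$ ones; $\mathrm{sort}(\lambda)=0^{n-k}1^k$ for $\lambda\in\binom{[n]}{k}$. Puzzles: work in the triangular lattice in the plane, whose unit edges make angles $0^\circ,60^\circ,120^\circ$ with the $x$-axis. Edge labels are the three symbols $0$, $1$, $10$ (where $10$ is a single symbol). A unit triangle (upward- or downward-pointing) with labeled edges is an allowed piece if its three labels read clockwise are $(0,0,0)$, $(1,1,1)$, or a cyclic rotation of $(1,0,10)$. Given a convex lattice polygon (sides along lattice directions) each of whose sides is labeled by a binary string, one symbol per unit edge, read clockwise around the polygon, a puzzle with this boundary is an assignment of labels to all unit lattice edges in the polygon which agrees with the prescribed labels on the boundary and for which every unit triangle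 in the polygon is an allowed piece. $\mathrm{Hex}(\alpha,\beta,\gamma,\delta,\epsilon,\zeta)$ is the number of puzzles on the regular hexagon of side length $a$ whose sides, in clockwise order SW, NW, North, NE, SE, South, are labeled respectively $\alpha,\beta,\gamma,\delta,\epsilon,\zeta$, each read clockwise. *)

(* Defs.v *)
From HB Require Import structures.
From mathcomp Require Import all_boot all_order all_algebra all_fingroup.
From mathcomp Require Import zify.

Set Implicit Arguments.
Unset Strict Implicit.
Unset Printing Implicit Defensive.

Import Order.TTheory GRing.Theory Num.Theory.

Local Open Scope ring_scope.

(* Binary words: [false] is the symbol 0 and [true] is the symbol 1. *)
Definition words (n k : nat) : {set n.-tuple bool} :=
  [set t : n.-tuple bool | count id t == k].

(* [L10] is the single symbol 10. *)
Variant label := L0 | L1 | L10.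

Definition label_code (l : label) : option bool :=
  match l with L0 => Some false | L1 => Some true | L10 => None end.

Definition label_decode (o : option bool) : label :=
  match o with Some false => L0 | Some true => L1 | None => L10 end.

Lemma label_codeK : cancel label_code label_decode.
Proof. by case. Qed.

HB.instance Definition _ := Countable.copy label (can_type label_codeK).
HB.instance Definition _ : isFinite label := CanIsFinite label_codeK.

Definition label_of_bool (b : bool) : label := if b then L1 else L0.

(* The directions 0, 60 and 120 degrees. *)
Variant dir := D0 | D60 | D120.

Definition dir_code (d : dir) : option bool :=
  match d with D0 => Some false | D60 => Some true | D120 => None end.

Definition dir_decode (o : option bool) : dir :=
  match o with Some false => D0 | Some true => D60 | None => D120 end.

Lemma dir_codeK : cancel dir_code dir_decode.
Proof. by case. Qed.

HB.instance Definition _ := Countable.copy dir (can_type dir_codeK).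
HB.instance Definition _ : isFinite dir := CanIsFinite dir_codeK.

(* The pair (x, y) is the lattice point x u + y v, where u and v are the unit
   vectors at angles 0 and 60 degrees; the unit vector at angle 120 degrees is
   then v - u. *)
Definition point : Type := (int * int)%type.

Definition vec (d : dir) : point :=
  match d with D0 => (1, 0) | D60 => (0, 1) | D120 => (-1, 1) end.

(* (p, d) is the unit edge joining p and p + vec d, so that each unit edge of
   the lattice has exactly one name. *)
Definition edge : Type := (point * dir)%type.

(* The edges, in clockwise order, of the two unit triangles whose lowest vertex
   (the left one, if there are two) is p.  The upward triangle p, p + u, p + v
   gives its left, right and bottom edges; the downward triangle
   p, p + v - u, p + v gives its top, right and left edges. *)
Definition up_triangle (p : point) : edge * edge * edge :=
  ((p, D60), (p + vec D0, D120), (p, D0)).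

Definition down_triangle (p : point) : edge * edge * edge :=
  ((p + vec D120, D0), (p, D60), (p, D120)).

Definition is_triangle (e f g : edge) : bool :=
  ((e, f, g) == up_triangle e.1) || ((e, f, g) == down_triangle f.1).

Lemma is_triangleP (e f g : edge) :
  reflect (exists p, (e, f, g) = up_triangle p \/ (e, f, g) = down_triangle p)
          (is_triangle e f g).
Proof.
apply: (iffP orP).
  by case=> /eqP H; [exists e.1; left | exists f.1; right].
by case=> p [] [-> -> ->]; [left | right]; rewrite /= eqxx.
Qed.

Definition allowed_piece (x y z : label) : bool :=
  (x, y, z) \in [:: (L0, L0, L0); (L1, L1, L1);
                    (L1, L0, L10); (L0, L10, L1); (L10, L1, L0)].

(* The regular hexagon of side a centred at the origin. *)
Definition int_range (a : nat) : seq int :=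
  [seq i%:Z - a%:Z | i <- iota 0 (2 * a).+1].

Definition hexagon (a : nat) : seq point :=
  [seq p <- [seq (x, y) | x <- int_range a, y <- int_range a]
     | `|p.1 + p.2| <= a%:Z].

Lemma mem_int_range (a : nat) (x : int) :
  (x \in int_range a) = (`|x| <= a%:Z).
Proof.
apply/mapP/idP => [[i]|].
  rewrite mem_iota add0n ltnS => /andP[_ ia] ->.
  rewrite ler_norml lerBrDr addNr lez_nat leq0n /= lerBlDr -PoszD lez_nat.
  by rewrite addnn -mul2n.
rewrite ler_norml => /andP[lx ux].
have x0 : 0 <= x + a%:Z by rewrite -lerBlDr sub0r.
exists `|(x + a%:Z)%R|%N; last by rewrite gez0_abs // addrK.
rewrite mem_iota add0n ltnS leq0n /= -lez_nat gez0_abs //.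
by rewrite mul2n -addnn PoszD lerD2r.
Qed.

Lemma mem_hexagon (a : nat) (p : point) :
  (p \in hexagon a) =
    [&& `|p.1| <= a%:Z, `|p.2| <= a%:Z & `|p.1 + p.2| <= a%:Z].
Proof.
rewrite mem_filter -!mem_int_range; case: p => x y /=.
have -> : ((x, y) \in [seq (x, y) | x <- int_range a, y <- int_range a])
  = (x \in int_range a) && (y \in int_range a).
  apply/allpairsP/andP => [[[x' y'] /= [Hx Hy [-> ->]]] //|[Hx Hy]].
  by exists (x, y).
by rewrite !mem_int_range andbC andbA.
Qed.

Definition edges (R : seq point) : seq edge :=
  [seq e <- [seq (p, d) | p <- R, d <- enum {: dir}] | e.1 + vec e.2 \in R].

Lemma mem_edges (R : seq point) (e : edge) :
  (e \in edges R) = (e.1 \in R) && (e.1 + vec e.2 \in R).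
Proof.
rewrite mem_filter andbC; case: e => p d /=; congr (_ && _).
apply/allpairsP/idP => [[[p' d'] /= [Hp _ [-> _]]] //|Hp].
by exists (p, d); rewrite mem_enum.
Qed.

Definition labelling (R : seq point) : Type := {ffun seq_sub (edges R) -> label}.

HB.instance Definition _ (R : seq point) := Finite.on (labelling R).

Definition edge_label (R : seq point) (P : labelling R) (e : edge) :
  option label := omap P (insub e).

Definition all_pieces_allowed (R : seq point) (P : labelling R) : bool :=
  [forall e, forall f, forall g,
     is_triangle (val e) (val f) (val g) ==> allowed_piece (P e) (P f) (P g)].

Variant side := SW | NW | North | NE | SE | South.

Definition side_code (s : side) : 'I_6 :=
  match s with
  | SW => inord 0 | NW => inord 1 | North => inord 2
  | NE => inord 3 | SE => inord 4 | South => inord 5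
  end.

Definition side_decode (i : 'I_6) : side :=
  nth SW [:: SW; NW; North; NE; SE; South] i.

Lemma side_codeK : cancel side_code side_decode.
Proof. by case; rewrite /side_decode /= inordK. Qed.

HB.instance Definition _ := Countable.copy side (can_type side_codeK).
HB.instance Definition _ : isFinite side := CanIsFinite side_codeK.

(* The j-th edge (0 <= j < a) of a side of the hexagon, in clockwise order.
   In clockwise order, the corners at which the sides start are (0, -a),
   (-a, 0), (-a, a), (0, a), (a, 0), (a, -a).  The clockwise walk traverses the
   last three sides from p + vec d to p, whence the extra shift by one. *)
Definition side_edge (a : nat) (s : side) (j : nat) : edge :=
  let A := a%:Z in let J := j%:Z in
  match s with
  | SW    => ((- J, J - A), D120)
  | NW    => ((- A, J), D60)
  | North => ((J - A, A), D0)
  | NE    => ((J + 1, A - J - 1), D120)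
  | SE    => ((A, - J - 1), D60)
  | South => ((A - J - 1, - A), D0)
  end.

Lemma side_edge_in (a : nat) (s : side) (j : 'I_a) :
  side_edge a s j \in edges (hexagon a).
Proof.
rewrite mem_edges !mem_hexagon.
have ja := ltn_ord j.
by case: s => /=; apply/andP; split; apply/and3P; split; lia.
Qed.

Definition has_boundary (a : nat) (w : side -> a.-tuple bool)
    (P : labelling (hexagon a)) : bool :=
  [forall s : side, forall j : 'I_a,
     edge_label P (side_edge a s j) == Some (label_of_bool (tnth (w s) j))].

Definition hex_puzzles (a : nat) (w : side -> a.-tuple bool) :
  {set labelling (hexagon a)} :=
  [set P | all_pieces_allowed P && has_boundary w P].

Definition sides (T : Type) (alpha beta gamma delta epsilon zeta : T)
    (s : side) : T :=
  match s with
  | SW => alpha | NW => beta | North => gamma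
  | NE => delta | SE => epsilon | South => zeta
  end.

Definition Hex (a : nat)
    (alpha beta gamma delta epsilon zeta : a.-tuple bool) : nat :=
  #|hex_puzzles (sides alpha beta gamma delta epsilon zeta)|.

(* Main.v *)
Require Import Defs.
From mathcomp Require Import all_boot all_order all_algebra all_fingroup.
From mathcomp Require Import zify ring.

(* Cut the hexagon along the six spokes joining its centre to its corners.  A
   conservation law of the puzzle pieces, applied to the six triangles in turn,
   shows that the symbol 10 does not occur on the spokes, so the number of
   puzzles is the trace of the product, in cyclic order, of six operators M_u,
   one for each side label u, where M_u has as entries the numbers of triangular
   puzzles with u on one side.  It remains to prove that the operators commute.

   Allow an additional rhombus, of weight y_i - y_j, at the crossing of the i-th
   line entering by the NW side with the j-th line entering by the NE side.  The
   resulting partition functions satisfy an exchange relation under the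
   transposition of y_i and y_{i+1}, with the same matrix acting on all three
   sides; it reduces to two Yang-Baxter equations and to an identity for
   triangles of size 2.  Starting from the sorted bottom word, the exchange
   relation produces covectors S with sum_w c(u, v, w) S(w) = S(u) S(v), that is,
   common left eigenvectors of all M_u.  They form a triangular system with
   respect to the number of inversions, which is invertible when the y_i are
   distinct; hence the M_u commute for y_i = i X over Z[X], and then at X = 0. *)

Set Implicit Arguments.
Unset Strict Implicit.
Unset Printing Implicit Defensive.

Import Order.TTheory GRing.Theory Num.Theory.

Local Open Scope ring_scope.

(** * Local identities *)

Lemma sum_label (R : nmodType) (F : label -> R) :
  \sum_l F l = F L0 + F L1 + F L10.
Proof.
rewrite (bigD1 L0) //= (bigD1 L1) //= (bigD1 L10) //= big1 ?addr0 ?addrA //.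
by case.
Qed.

(* The order 0 < 10 < 1. *)
Definition label_gt (x y : label) : bool :=
  match x, y with
  | L1, L0 | L1, L10 | L10, L0 => true
  | _, _ => false
  end.

Section Weights.
Variable R : comNzRingType.
Implicit Types (u w : R) (g t h s b x y : label).

Definition piece g t h : R := (allowed_piece g t h)%:R.

(* The lines labelled [g] and [t] leave a rhombus with labels [g'] and [s].  The
   first term splits the rhombus into two puzzle pieces along an edge labelled [h];
   the second one is the additional rhombus. *)
Definition crossing u g t g' s : R :=
  \sum_h piece g t h * piece h g' s
  + [&& g == L0, t == L1, g' == L0 & s == L1]%:R * u.

Lemma pieceE g t h : piece g t h =
  match g, t, h with
  | L0, L0, L0 | L1, L1, L1 | L1, L0, L10 | L0, L10, L1 | L10, L1, L0 => 1
  | _, _, _ => 0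
  end.
Proof. by case: g; case: t; case: h. Qed.

(** The transition table of a crossing. Splitting the rhombus gives every nonzero entry except $0, 1
    \to 0, 1$, which comes from the additional rhombus alone. *)
Lemma crossing_sum u g t (F : label -> label -> R) :
  \sum_h \sum_s crossing u g t h s * F h s =
  match g, t with
  | L0, L0 | L10, L1 => F L0 L0 + F L10 L1
  | L1, L1 | L0, L10 => F L0 L10 + F L1 L1
  | L1, L0 => F L1 L0
  | L0, L1 => u * F L0 L1
  | _, _ => 0
  end.
Proof.
rewrite !sum_label /crossing !sum_label !pieceE.
by case: g; case: t; rewrite /= ?(mul0r, mul1r, mulr0, addr0, add0r).
Qed.

Definition green_crossing u1 u2 (K : label -> label -> label -> R) g1 g2 t : R :=
  \sum_h2 \sum_m crossing u2 g2 t h2 m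
    * \sum_h1 \sum_s crossing u1 g1 m h1 s * K h1 h2 s.

Definition red_crossing u1 u2 (K : label -> label -> label -> R) g t1 t2 : R :=
  \sum_m \sum_s1 crossing u1 g t1 m s1
    * \sum_h \sum_s2 crossing u2 m t2 h s2 * K h s1 s2.

(** The matrix $1 - wE$, where $E$ exchanges a pair in decreasing order; [rmxT] is its transpose,
    hence the reversed test. *)
Definition rmx w (F : label -> label -> R) x y : R :=
  F x y - (label_gt x y)%:R * w * F y x.

Definition rmxT w (F : label -> label -> R) x y : R :=
  F x y - (label_gt y x)%:R * w * F y x.

(** Green lines enter by the NW side, red lines by the NE side. By the transition table this is a
    finite check over the three incoming labels. *)
Lemma yang_baxter_green u1 u2 K g1 g2 t :
  rmx (u1 - u2) (fun g1 g2 => green_crossing u2 u1 K g1 g2 t) g1 g2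
  = green_crossing u1 u2
      (fun h1 h2 s => rmx (u1 - u2) (fun h1 h2 => K h1 h2 s) h1 h2) g1 g2 t.
Proof.
rewrite /rmx /green_crossing.
case: g1; case: g2; case: t; rewrite !crossing_sum /=
  ?(mul0r, mul1r, addr0, subr0) //; ring.
Qed.

(** The parameter of a red line enters a crossing negatively, hence [- u1] and [- u2]; the factor
    [u1 - u2] is then the same for both colours. *)
Lemma yang_baxter_red u1 u2 K g t1 t2 :
  rmx (u1 - u2) (fun t1 t2 => red_crossing (- u2) (- u1) K g t1 t2) t1 t2
  = red_crossing (- u1) (- u2)
      (fun h s1 s2 => rmx (u1 - u2) (fun s1 s2 => K h s1 s2) s1 s2) g t1 t2.
Proof.
rewrite /rmx /red_crossing.
case: g; case: t1; case: t2; rewrite !crossing_sum /=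
  ?(mul0r, mul1r, addr0, subr0) //; ring.
Qed.

Definition triangle2 u g1 g2 t1 t2 b1 b2 : R :=
  \sum_h \sum_s crossing u g2 t1 h s * (piece g1 s b1 * piece h t2 b2).

End Weights.

Definition label_piece x y z : nat :=
  match x, y, z with
  | L0, L0, L0 | L1, L1, L1 | L1, L0, L10 | L0, L10, L1 | L10, L1, L0 => 1
  | _, _, _ => 0
  end.

(* The coefficient of [u ^ e] in [triangle2 u g1 g2 t1 t2 b1 b2]. *)
Definition label_triangle2 (e : bool) g1 g2 t1 t2 b1 b2 : nat :=
  let F h s := (label_piece g1 s b1 * label_piece h t2 b2)%N in
  match e, g2, t1 with
  | false, L0, L0 | false, L10, L1 => F L0 L0 + F L10 L1
  | false, L1, L1 | false, L0, L10 => F L0 L10 + F L1 L1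
  | false, L1, L0 => F L1 L0
  | true, L0, L1 => F L0 L1
  | _, _, _ => 0
  end.

(** These are the coefficients of $w$, $w^2$ and $w^3$ in [triangle2_exchange]. Stated over the
    natural numbers, without subtraction, all $3^6$ cases hold by computation. *)
Lemma label_triangle2_exchange g1 g2 t1 t2 b1 b2 :
  let T := label_triangle2 in
  let d1 : nat := label_gt g1 g2 in
  let d2 : nat := label_gt t1 t2 in
  let d3 : nat := label_gt b2 b1 in
  [/\ (T true g1 g2 t1 t2 b1 b2 * 2 + d3 * T false g1 g2 t1 t2 b2 b1)%N
      = (d1 * T false g2 g1 t1 t2 b1 b2 + d2 * T false g1 g2 t2 t1 b1 b2)%N,
      (d1 * d2 * T false g2 g1 t2 t1 b1 b2)%N
      = (d1 * T true g2 g1 t1 t2 b1 b2 + d2 * T true g1 g2 t2 t1 b1 b2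
          + d3 * T true g1 g2 t1 t2 b2 b1)%N
    & (d1 * d2 * T true g2 g1 t2 t1 b1 b2 = 0)%N ].
Proof.
by case: g1; case: g2; case: t1; case: t2; case: b1; case: b2.
Qed.

Section Triangle2.
Variable R : comNzRingType.
Implicit Types (u w : R) (g t h s b x y : label).

Lemma triangle2E u g1 g2 t1 t2 b1 b2 :
  triangle2 u g1 g2 t1 t2 b1 b2
  = (label_triangle2 false g1 g2 t1 t2 b1 b2)%:R
    + u * (label_triangle2 true g1 g2 t1 t2 b1 b2)%:R.
Proof.
have pE x y z : piece R x y z = (label_piece x y z)%:R by case: x; case: y; case: z.
rewrite /triangle2 crossing_sum !pE -!natrM.
by case: g2; case: t1; rewrite /= -?natrD ?mulr0 ?addr0 ?add0r.
Qed.

Lemma triangle2_exchange w g1 g2 t1 t2 b1 b2 :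
  rmx w (fun g1 g2 =>
    rmx w (fun t1 t2 => triangle2 w g1 g2 t1 t2 b1 b2) t1 t2) g1 g2
  = rmxT w (triangle2 (- w) g1 g2 t1 t2) b1 b2.
Proof.
rewrite /rmx /rmxT !triangle2E.
have [/(congr1 (GRing.natmul (1 : R))) + /(congr1 (GRing.natmul (1 : R))) + /(congr1 (GRing.natmul (1 : R)))] :=
  label_triangle2_exchange g1 g2 t1 t2 b1 b2.
rewrite !(natrD, natrM) => e1 e2 e3.
apply/eqP; rewrite -subr_eq0; apply/eqP.
set d1 := (label_gt g1 g2)%:R in e1 e2 e3 *.
set d2 := (label_gt t1 t2)%:R in e1 e2 e3 *.
set d3 := (label_gt b2 b1)%:R in e1 e2 e3 *.
move: e1 e2 e3.
move=> /eqP; rewrite -subr_eq0 => /eqP e1 /eqP; rewrite -subr_eq0 => /eqP e2 e3.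
(* The difference of the two sides is a polynomial in [w] without constant term, whose coefficients
   are the three vanishing expressions. *)
have combine E1 E2 E3 X : E1 = 0 -> E2 = 0 -> E3 = 0 ->
  X = w * E1 + w ^+ 2 * E2 + w ^+ 3 * E3 -> X = 0.
  by move=> -> -> -> ->; rewrite !mulr0 !addr0.
apply: (combine _ _ _ _ e1 e2 e3); ring.
Qed.
End Triangle2.

(** * The exchange relation *)

Fixpoint swap_at (T : Type) (i : nat) (s : seq T) : seq T :=
  match i, s with
  | 0, x :: y :: s' => y :: x :: s'
  | i'.+1, x :: s' => x :: swap_at i' s'
  | _, _ => s
  end.

Lemma size_swap_at (T : Type) i (s : seq T) : size (swap_at i s) = size s.
Proof. by elim: i s => [|i IH] [|x [|y s]] //=; rewrite IH. Qed.

Definition descent (i : nat) (s : seq label) : bool :=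
  label_gt (nth L0 s i) (nth L0 s i.+1).

Definition ascent (i : nat) (s : seq label) : bool :=
  label_gt (nth L0 s i.+1) (nth L0 s i).

Section Triangle.
Variable R : comNzRingType.
Implicit Types (x y u w : R) (ys : seq R) (gs rs bs : seq label).

Definition rmx_at i w (F : seq label -> R) gs : R :=
  F gs - (descent i gs)%:R * w * F (swap_at i gs).

Definition rmxT_at i w (F : seq label -> R) gs : R :=
  F gs - (ascent i gs)%:R * w * F (swap_at i gs).

(* A line of parameter [x] and label [t] crosses the lines [gs] of parameters
   [ys], the last of them first. *)
Fixpoint pass x ys gs (t : label) (K : seq label -> label -> R) {struct ys} : R :=
  match ys, gs with
  | y :: ys', g :: gs' =>
      pass x ys' gs' t (fun hs m =>
        \sum_h \sum_s crossing (y - x) g m h s * K (h :: hs) s)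
  | _, _ => K [::] t
  end.

(* The words [gs], [rs] and [bs] label the NW side upwards, the NE side downwards
   and the bottom side from left to right.  Each step removes the strip along the
   NW side, that is, the first line of the NE side. *)
Fixpoint triangle ys gs rs bs {struct ys} : R :=
  match ys, gs, rs, bs with
  | y :: ys', g :: gs', r :: rs', b :: bs' =>
      pass y ys' gs' r (fun hs s => piece R g s b * triangle ys' hs rs' bs')
  | _, _, _, _ => 1
  end.

Arguments triangle : simpl never.

Lemma triangle_cons y ys g gs r rs b bs :
  triangle (y :: ys) (g :: gs) (r :: rs) (b :: bs)
  = pass y ys gs r (fun hs s => piece R g s b * triangle ys hs rs bs).
Proof. by []. Qed.

Lemma eq_pass x ys gs t K1 K2 :
  (forall hs s, size hs = minn (size ys) (size gs) -> K1 hs s = K2 hs s) ->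
  pass x ys gs t K1 = pass x ys gs t K2.
Proof.
elim: ys gs K1 K2 => [|y ys IH] [|g gs] K1 K2 /= eqK; try by apply: eqK.
apply: IH => hs m szh.
by apply: eq_bigr => h _; apply: eq_bigr => s _; rewrite eqK //= szh minnSS.
Qed.

(** Linearity in the continuation [K] takes the place of matrix algebra: it allows crossings to be
    reordered and local identities to be applied inside a pass. *)
Lemma pass_linear x ys gs t c K1 K2 :
  pass x ys gs t (fun hs s => K1 hs s + c * K2 hs s)
  = pass x ys gs t K1 + c * pass x ys gs t K2.
Proof.
elim: ys gs K1 K2 => [|y ys IH] [|g gs] K1 K2 //=.
rewrite -IH; apply: eq_pass => hs m _.
rewrite mulr_sumr -big_split; apply: eq_bigr => h _.
rewrite mulr_sumr -big_split; apply: eq_bigr => s _ /=; ring.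
Qed.

Lemma pass_scale x ys gs t c K :
  pass x ys gs t (fun hs s => c * K hs s) = c * pass x ys gs t K.
Proof.
have p0 : pass x ys gs t (fun _ _ => 0) = 0.
  elim: ys gs {c K} => [|y ys IH] [|g gs] //=.
  rewrite -[RHS](IH gs); apply: eq_pass => hs m _.
  by apply: big1 => h _; apply: big1 => s _; rewrite mulr0.
rewrite -[RHS]add0r -p0 -pass_linear.
by apply: eq_pass => hs s _; rewrite add0r.
Qed.

Lemma pass_sum x ys gs t (F : label -> seq label -> label -> R) :
  pass x ys gs t (fun hs s => \sum_l F l hs s)
  = \sum_l pass x ys gs t (F l).
Proof.
rewrite sum_label -[pass x ys gs t (F L1)]mul1r -[pass x ys gs t (F L10)]mul1r.
rewrite -!pass_linear; apply: eq_pass => hs s _.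
by rewrite sum_label !mul1r.
Qed.

(** The red line meets the lines [i.+1] and [i] in succession, and the exchange matrix slides
    through these two crossings by the green Yang-Baxter equation. *)
Lemma pass_rmx_green i x ys gs t K :
  (i.+1 < size ys)%N -> size gs = size ys ->
  rmx_at i (nth 0 ys i - nth 0 ys i.+1)
    (fun gs => pass x (swap_at i ys) gs t K) gs
  = pass x ys gs t
      (fun hs s => rmx_at i (nth 0 ys i - nth 0 ys i.+1) (fun hs => K hs s) hs).
Proof.
elim: i ys gs K => [|i IH] [|y1 ys] [|g1 gs] K //=.
  case: ys gs => [|y2 ys] [|g2 gs] //= _ _.
  rewrite /rmx_at /descent /=.
  rewrite -mulNr -pass_linear; apply: eq_pass => hs m _.
  (* Only the difference of the two crossing parameters enters the matrix, so [x] cancels. *)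
  have := yang_baxter_green (y1 - x) (y2 - x)
    (fun h1 h2 => K [:: h1, h2 & hs]) g1 g2 m.
  have -> : y1 - x - (y2 - x) = y1 - y2 by ring.
  by rewrite /rmx /green_crossing mulNr.
rewrite ltnS => ltys [szgs].
set w := nth 0 ys i - _.
have := IH ys gs (fun hs m => \sum_h \sum_s crossing (y1 - x) g1 m h s * K (h :: hs) s) ltys szgs.
rewrite -/w /rmx_at /= => ->; apply: eq_pass => hs m _.
rewrite -mulNr mulr_sumr -big_split; apply: eq_bigr => h _.
rewrite mulr_sumr -big_split; apply: eq_bigr => s _ /=.
rewrite /descent /=; ring.
Qed.

Definition double_pass x1 x2 ys gs t1 t2 (K : seq label -> label -> label -> R) : R :=
  pass x1 ys gs t1 (fun hs s1 => pass x2 ys hs t2 (fun ks s2 => K ks s1 s2)).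

Lemma eq_double_pass x1 x2 ys gs t1 t2 K1 K2 :
  size gs = size ys ->
  (forall hs s1 s2, size hs = size ys -> K1 hs s1 s2 = K2 hs s1 s2) ->
  double_pass x1 x2 ys gs t1 t2 K1 = double_pass x1 x2 ys gs t1 t2 K2.
Proof.
move=> sz eqK; rewrite /double_pass; apply: eq_pass => hs s1; rewrite sz minnn => szh.
by apply: eq_pass => ks s2; rewrite szh minnn; apply: eqK.
Qed.

Lemma double_pass_linear x1 x2 ys gs t1 t2 c K1 K2 :
  double_pass x1 x2 ys gs t1 t2 (fun hs s1 s2 => K1 hs s1 s2 + c * K2 hs s1 s2)
  = double_pass x1 x2 ys gs t1 t2 K1 + c * double_pass x1 x2 ys gs t1 t2 K2.
Proof.
rewrite /double_pass -pass_linear; apply: eq_pass => hs s1 _.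
exact: pass_linear.
Qed.

(** The crossing of the first red line with [y] and those of the second one with [ys] share no edge,
    so both red lines can be made to cross [y] last. *)
Lemma double_pass_cons x1 x2 y ys g gs t1 t2 K :
  size gs = size ys ->
  double_pass x1 x2 (y :: ys) (g :: gs) t1 t2 K
  = double_pass x1 x2 ys gs t1 t2 (fun hs m1 m2 =>
      red_crossing (y - x1) (y - x2) (fun h => K (h :: hs)) g m1 m2).
Proof.
move=> sz; rewrite /double_pass /=; apply: eq_pass => hs m1 _ /=; rewrite /red_crossing.
rewrite pass_sum; apply: eq_bigr => h1 _.
rewrite pass_sum; apply: eq_bigr => s1 _.
by rewrite pass_scale.
Qed.

(** At each green line in turn, the red Yang-Baxter equation moves the exchange matrix past the two
    crossings with that line. *)
Lemma double_pass_rmx_red x1 x2 ys gs t1 t2 K :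
  size gs = size ys ->
  rmx (x1 - x2) (fun t1 t2 => double_pass x2 x1 ys gs t1 t2 K) t1 t2
  = double_pass x1 x2 ys gs t1 t2
      (fun hs s1 s2 => rmx (x1 - x2) (fun s1 s2 => K hs s1 s2) s1 s2).
Proof.
elim: ys gs K => [|y ys IH] [|g gs] K //= [sz].
rewrite /rmx !double_pass_cons // -/(rmx _ _ _ _).
have := IH gs (fun hs m1 m2 =>
      red_crossing (y - x2) (y - x1) (fun h => K (h :: hs)) g m1 m2) sz.
rewrite /rmx => ->; apply: eq_double_pass => // hs m1 m2 _.
have := yang_baxter_red (x1 - y) (x2 - y) (fun h => K (h :: hs)) g m1 m2.
by rewrite !opprB /rmx; have -> : x1 - y + (y - x2) = x1 - x2 by ring.
Qed.

(** Isolates the triangle of size 2 in the left corner, where the lines of [y1] and [y2] meet each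
    other, from their crossings with the other green lines. *)
Lemma triangle_cons2 y1 y2 ys g1 g2 gs r1 r2 rs b1 b2 bs :
  size gs = size ys ->
  triangle [:: y1, y2 & ys] [:: g1, g2 & gs] [:: r1, r2 & rs] [:: b1, b2 & bs]
  = double_pass y1 y2 ys gs r1 r2 (fun hs m1 m2 =>
      triangle2 (y2 - y1) g1 g2 m1 m2 b1 b2 * triangle ys hs rs bs).
Proof.
move=> sz; rewrite triangle_cons /double_pass /=; apply: eq_pass => hs m1 _ /=.

transitivity (\sum_h \sum_s pass y2 ys hs r2 (fun ks m2 =>
    crossing (y2 - y1) g2 m1 h s
      * (piece R g1 s b1 * (piece R h m2 b2 * triangle ys ks rs bs)))).
  by apply: eq_bigr => h _; apply: eq_bigr => s _; rewrite !pass_scale.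
under eq_bigr do rewrite -pass_sum; rewrite -pass_sum.
apply: eq_pass => ks m2 _.
rewrite /triangle2 mulr_suml; apply: eq_bigr => h _.
by rewrite mulr_suml; apply: eq_bigr => s _; rewrite !mulrA.
Qed.

(** Removing strips along the NW side reduces to [i = 0], the NW exchange being carried through a
    strip by [pass_rmx_green]. For [i = 0], [double_pass_rmx_red] carries the NE exchange to the
    corner of size 2, where both exchanges turn into the one on the bottom side. *)
Lemma triangle_exchange i ys gs rs bs :
  (i.+1 < size ys)%N ->
  size gs = size ys -> size rs = size ys -> size bs = size ys ->
  let w := nth 0 ys i - nth 0 ys i.+1 in
  rmx_at i w (fun gs =>
    rmx_at i w (fun rs => triangle (swap_at i ys) gs rs bs) rs) gs
  = rmxT_at i w (triangle ys gs rs) bs.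
Proof.
elim: i ys gs rs bs => [|i IH] [|y1 ys] [|g1 gs] [|r1 rs] [|b1 bs] //=.
  case: ys gs rs bs => [|y2 ys] [|g2 gs] [|r2 rs] [|b2 bs] //= _.
  move=> [szg] [szr] [szb].
  have E u v a b c d e f := triangle_cons2 u v a b c d rs e f bs szg.
  have red t1 t2 K := double_pass_rmx_red y1 y2 t1 t2 K szg.
  rewrite /rmx_at /rmxT_at /descent /ascent /= !E.
  rewrite /rmx in red; rewrite !red -!mulNr -!double_pass_linear.
  apply: eq_double_pass => // hs s1 s2 _.
  have := triangle2_exchange (y1 - y2) g1 g2 s1 s2 b1 b2.
  rewrite opprB /rmx /rmxT => /(congr1 (fun z => z * triangle ys hs rs bs)) eqT.
  transitivity
    ((triangle2 (y1 - y2) g1 g2 s1 s2 b1 b2 -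
      (label_gt s1 s2)%:R * (y1 - y2) * triangle2 (y1 - y2) g1 g2 s2 s1 b1 b2 -
      (label_gt g1 g2)%:R * (y1 - y2) *
      (triangle2 (y1 - y2) g2 g1 s1 s2 b1 b2 -
       (label_gt s1 s2)%:R * (y1 - y2) * triangle2 (y1 - y2) g2 g1 s2 s1 b1 b2)) *
      triangle ys hs rs bs); first by ring.
  by rewrite eqT; ring.
rewrite ltnS => ltys [szg] [szr] [szb].
set w := nth 0 ys i - _.
transitivity (rmx_at i w (fun gs => pass y1 (swap_at i ys) gs r1 (fun hs s =>
    piece R g1 s b1 * rmx_at i w (fun rs => triangle (swap_at i ys) hs rs bs) rs)) gs).
  have inner hs0 : pass y1 (swap_at i ys) hs0 r1 (fun hs s =>
      piece R g1 s b1 * rmx_at i w (fun rs => triangle (swap_at i ys) hs rs bs) rs)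
    = pass y1 (swap_at i ys) hs0 r1 (fun hs s =>
        piece R g1 s b1 * triangle (swap_at i ys) hs rs bs)
      - (descent i rs)%:R * w * pass y1 (swap_at i ys) hs0 r1 (fun hs s =>
        piece R g1 s b1 * triangle (swap_at i ys) hs (swap_at i rs) bs).
    rewrite -mulNr -pass_linear; apply: eq_pass => hs s _; rewrite /rmx_at; ring.
  by rewrite /rmx_at /= !triangle_cons !inner.
rewrite pass_rmx_green // -/w.
rewrite /rmxT_at /= !triangle_cons -mulNr -pass_linear.
apply: eq_pass => hs s; rewrite szg minnn => szh.
transitivity (piece R g1 s b1 * rmx_at i w (fun hs =>
    rmx_at i w (fun rs => triangle (swap_at i ys) hs rs bs) rs) hs).
  by rewrite /rmx_at; ring.
rewrite IH // -/w /rmxT_at /ascent /=; ring.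
Qed.
End Triangle.
Arguments triangle {R} ys gs rs bs : simpl never.

(** * Conservation law and sorted bottom words *)

Lemma sum_neq0 (R : nmodType) (I : finType) (F : I -> R) :
  \sum_i F i != 0 -> exists i, F i != 0.
Proof.
move=> nz; apply/existsP; apply: contra_neqT nz; rewrite negb_exists => /forallP F0.
by apply: big1 => i _; apply/eqP; rewrite -[_ == _]negbK F0.
Qed.

Local Notation word := (map label_of_bool).

Lemma nth_word s i : nth L0 (word s) i = label_of_bool (nth false s i).
Proof. by elim: s i => [|b s IH] [|i] //=. Qed.

Lemma word_inj : injective word.
Proof. by apply: inj_map; do 2!case. Qed.

Lemma map_swap_at (T T' : Type) (f : T -> T') i s :
  map f (swap_at i s) = swap_at i (map f s).
Proof. by elim: i s => [|i IH] [|x [|y s]] //=; rewrite IH. Qed.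

Section Conservation.
Variable R : comNzRingType.
Implicit Types (x y : R) (ys : seq R) (gs rs bs : seq label) (u v w : seq bool).

(** Together with [crossing_conservation], this sums to a relation among the three sides of a
    triangle, since the counts on interior edges cancel. *)
Lemma piece_conservation g t b :
  piece R g t b != 0 -> ((g == L10) + (b == L1) = (t != L0))%N.
Proof. by rewrite pieceE; case: g; case: t; case: b; rewrite ?eqxx. Qed.

Lemma crossing_conservation (u : R) g t h s :
  crossing u g t h s != 0 ->
  ((g == L10) + (s != L0) = (h == L10) + (t != L0))%N.
Proof.
rewrite /crossing sum_label !pieceE.
by case: g; case: t; case: h; case: s;
  rewrite /= ?(mul0r, mulr0, mul1r, addr0, eqxx).
Qed.

(** A nonzero value is witnessed by one nonzero term, along which the local laws add up. *)
Lemma pass_conservation x ys gs t K :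
  size gs = size ys -> pass x ys gs t K != 0 ->
  exists hs s, [/\ size hs = size gs, K hs s != 0
    & (count_mem L10 gs + (s != L0) = count_mem L10 hs + (t != L0))%N].
Proof.
elim: ys gs K => [|y ys IH] [|g gs] K //=; first by move=> _ nz; exists [::], t.
move=> [sz] /(IH _ _ sz) [hs [m [szh /sum_neq0 [h /sum_neq0 [s nz]] cons]]].
exists (h :: hs), s; split; first by rewrite /= szh.
  by apply: contraNneq nz => ->; rewrite mulr0.
have /crossing_conservation : crossing (y - x) g m h s != 0.
  by apply: contraNneq nz => ->; rewrite mul0r.
by move: cons => /=; do ![case: (_ == _)]; move=> /=; lia.
Qed.

Lemma triangle_conservation ys gs rs bs :
  size gs = size ys -> size rs = size ys -> size bs = size ys ->
  triangle ys gs rs bs != 0 ->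
  (count_mem L10 gs + count_mem L1 bs = count (predC1 L0) rs)%N.
Proof.
elim: ys gs rs bs => [|y ys IH] [|g gs] [|r rs] [|b bs] //= [szg] [szr] [szb].
rewrite triangle_cons => /(pass_conservation szg) [hs [s [szh nz cons]]].
have /piece_conservation : piece R g s b != 0.
  by apply: contraNneq nz => ->; rewrite mul0r.
have /IH : triangle ys hs rs bs != 0.
  by apply: contraNneq nz => ->; rewrite mulr0.
rewrite szh => /(_ szg szr szb); move: cons => /=.
by do ![case: (_ == _)]; move=> /=; lia.
Qed.

Lemma count_L10_word s : count_mem L10 (word s) = 0%N.
Proof. by rewrite count_map -(count_pred0 s); apply: eq_count; case. Qed.

Lemma count_L1_word s : count_mem L1 (word s) = count id s.
Proof. by rewrite count_map; apply: eq_count; case. Qed.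

Lemma count_neq0_word s : count (predC1 L0) (word s) = count id s.
Proof. by rewrite count_map; apply: eq_count; case. Qed.

(** When [b] is at most every letter of [w], the outgoing word [w] forces each crossing to leave its
    two labels unchanged; the additional rhombus would need [b = 1] against a letter 0. *)
Lemma pass_delta x ys gs b w F :
  size gs = size ys -> size w = size ys -> all (implb b) w ->
  pass x ys gs (label_of_bool b) (fun hs s => (hs == word w)%:R * F s)
  = (gs == word w)%:R * F (label_of_bool b).
Proof.
elim: ys gs w F => [|y ys IH] [|g gs] [|c w] F //= [szg] [szw] /andP[bc allw].
transitivity (pass x ys gs (label_of_bool b) (fun hs m => (hs == word w)%:R
    * \sum_s crossing (y - x) g m (label_of_bool c) s * F s)).
  apply: eq_pass => hs m _; rewrite exchange_big mulr_sumr.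
  apply: eq_bigr => s _; rewrite (bigD1 (label_of_bool c)) //= big1 ?addr0.
    by rewrite eqseq_cons eqxx /= mulrCA.
  by move=> l /negbTE ne; rewrite eqseq_cons ne /= mul0r mulr0.
rewrite IH // eqseq_cons andbC.
case: (gs == _); last by rewrite !mul0r.
rewrite mul1r /= sum_label /crossing !sum_label !pieceE.
by case: g; case: b bc {IH allw}; case: c => //=; rewrite /= ?(mul0r, mulr0, mul1r, addr0, add0r).
Qed.

Lemma sorted_cons_all b w : path implb b w -> all (implb b) w.
Proof. by apply: order_path_min; do 3!case. Qed.

Lemma triangle_diagonal ys gs w :
  size gs = size ys -> size w = size ys -> sorted implb w ->
  triangle ys gs (word w) (word w) = (gs == word w)%:R.
Proof.
elim: ys gs w => [|y ys IH] [|g gs] [|b w] //= [szg] [szw] pathw.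
rewrite triangle_cons.
transitivity (pass y ys gs (label_of_bool b) (fun hs s =>
    (hs == word w)%:R * piece R g s (label_of_bool b))).
  apply: eq_pass => hs s; rewrite szg minnn => szh.
  by rewrite IH 1?mulrC // (path_sorted pathw).
rewrite pass_delta //; last exact: sorted_cons_all.
rewrite eqseq_cons andbC; case: (gs == _); last by rewrite mul0r.
by rewrite mul1r /= pieceE; case: g; case: b {pathw}.
Qed.

(** Conservation gives [v] and [w] equally many ones. If [w] starts with 1, both consist of ones
    only. Otherwise conservation in the strip and in the rest shows that [v] starts with 0 and that
    no 10 enters the smaller triangle, so the induction continues. *)
Lemma triangle_sorted_bottom ys gs v w :
  size gs = size ys -> size v = size ys -> size w = size ys ->
  sorted implb w -> count_mem L10 gs = 0%N ->
  triangle ys gs (word v) (word w) != 0 -> v = w.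
Proof.
elim: ys gs v w => [|y ys IH] [|g gs] [|a v] [|b w] // szg szv szw pathw g0 nz.
have := triangle_conservation szg _ _ nz.
rewrite !size_map g0 count_L1_word count_neq0_word => /(_ szv szw) cnt.
case: b cnt pathw nz szw => /= cnt pathw nz [szw].
  have /eqP w1 : count id w == size w.
    by rewrite -all_count; apply: sub_all (sorted_cons_all pathw).
  have aT : a by move: cnt szv (count_size id v) => /=; case: (a); lia.
  rewrite aT; congr cons.
  have all1 (s : seq bool) : count id s == size s -> s = nseq (size s) true.
    by rewrite -all_count; elim: s => [|[] s IHs] //= /IHs {1}->.
  rewrite (all1 w) ?w1 // (all1 v); first by move: szv => /= [->]; rewrite szw.
  by apply/eqP; move: cnt szv w1; rewrite aT /=; lia.
move: nz; rewrite triangle_cons => /pass_conservation.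
case: szg => szg /(_ szg) [hs [s [szh nz cons]]].
have nzt : triangle ys hs (word v) (word w) != 0.
  by apply: contraNneq nz => ->; rewrite mulr0.
have := triangle_conservation _ _ _ nzt; rewrite !size_map szh.
case: szv => szv /(_ szg szv szw); rewrite count_L1_word count_neq0_word => cnt'.
have aF : a = false by case: (a) cnt; lia.
rewrite aF (IH hs v w) ?szh //; last by lia.
exact: path_sorted pathw.
Qed.

Lemma triangle_bottom_sorted ys u v w :
  size u = size ys -> size v = size ys -> size w = size ys -> sorted implb w ->
  triangle ys (word u) (word v) (word w) = (u == w)%:R * (v == w)%:R.
Proof.
move=> szu szv szw sw.
have [->|ne] := eqVneq v w.
  by rewrite triangle_diagonal ?size_map // mulr1 inj_eq //; apply: word_inj.
rewrite mulr0; apply: contraNeq ne => nz; apply/eqP.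
by apply: triangle_sorted_bottom nz; rewrite ?size_map ?count_L10_word.
Qed.
End Conservation.

(** Serves to evaluate polynomial parameters at $X = 0$. *)
Lemma triangle_rmorph (R R' : comNzRingType) (f : {rmorphism R -> R'}) ys gs rs bs :
  f (triangle ys gs rs bs) = triangle (map f ys) gs rs bs.
Proof.
have fpiece g t b : f (piece R g t b) = piece R' g t b by rewrite rmorph_nat.
have fcross u g t h s : f (crossing u g t h s) = crossing (f u) g t h s.
  rewrite rmorphD rmorphM rmorph_nat rmorph_sum; congr (_ + _).
  by apply: eq_bigr => l _; rewrite rmorphM !fpiece.
have fpass x zs hs t K : f (pass x zs hs t K)
    = pass (f x) (map f zs) hs t (fun hs s => f (K hs s)).
  elim: zs hs K => [|z zs IH] [|h hs] K //=; rewrite IH.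
  apply: eq_pass => ks m _; rewrite rmorph_sum; apply: eq_bigr => k _.
  rewrite rmorph_sum; apply: eq_bigr => s _.
  by rewrite rmorphM fcross rmorphB.
elim: ys gs rs bs => [|y ys IH] [|g gs] [|r rs] [|b bs] /=; try by rewrite rmorph1.
rewrite !triangle_cons fpass; apply: eq_pass => hs s _.
by rewrite rmorphM fpiece IH.
Qed.

(** * Commutation *)

Lemma swap_atK (T : Type) i : involutive (@swap_at T i).
Proof. by elim: i => [|i IH] [|x [|y s]] //=; rewrite ?IH //; case: i {IH}. Qed.

Definition swap_tuple (T : Type) n i (t : n.-tuple T) : n.-tuple T :=
  Tuple (introT eqP (etrans (size_swap_at i t) (size_tuple t))).

Lemma swap_tupleK (T : Type) n i : involutive (@swap_tuple T n i).
Proof. by move=> t; apply: val_inj; apply: swap_atK. Qed.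

Lemma perm_swap_at (T : eqType) i (s : seq T) : perm_eq (swap_at i s) s.
Proof.
elim: i s => [|i IH] [|x [|y s]] //=; rewrite ?perm_cons //.
by apply/seq.permP => p /=; rewrite addnCA.
Qed.

Lemma nth_swap_at (T : Type) (x0 : T) i s : (i.+1 < size s)%N ->
  (nth x0 (swap_at i s) i = nth x0 s i.+1) * (nth x0 (swap_at i s) i.+1 = nth x0 s i).
Proof. by elim: i s => [|i IH] [|x [|y s]] //= lti; rewrite !IH. Qed.

Fixpoint inversions (s : seq bool) : nat :=
  if s is b :: s' then (b * count negb s' + inversions s')%N else 0.

Definition bit_descent i (s : seq bool) : bool := nth false s i && ~~ nth false s i.+1.

Lemma inversions_swap i s : (i.+1 < size s)%N -> bit_descent i s ->
  inversions s = (inversions (swap_at i s)).+1.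
Proof.
have count_swap j (s' : seq bool) : count negb (swap_at j s') = count negb s'.
  by elim: j s' => [|j IH] [|x [|y s']] //=; rewrite ?IH //= addnCA.
elim: i s => [|i IH] [|b s] //.
  by case: b s => [] [|[] s] //= _ _; lia.
by rewrite ltnS /= count_swap => lti /(IH s lti) ->; rewrite addnS.
Qed.

Lemma descent_word i s : descent i (word s) = bit_descent i s.
Proof. by rewrite /descent !nth_word /bit_descent; do 2!case: (nth _ _ _). Qed.

Lemma sorted_no_descent s :
  (forall i, (i.+1 < size s)%N -> ~~ bit_descent i s) -> sorted implb s.
Proof.
move=> nodesc; apply/(sortedP false) => i lti.
by move: (nodesc i lti); rewrite /bit_descent; do 2!case: (nth _ _ _).
Qed.

(** * Multiplicative covectors *)

Section Eigenvectors.
Variables (R : comNzRingType) (n : nat).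
Implicit Types (ys : seq R) (S : n.-tuple bool -> R).

(** [S] respects the product with structure constants [triangle]; equivalently, it is a left
    eigenvector of each $M_u$, with eigenvalue [S u]. *)
Definition multiplicative ys S : Prop :=
  forall u v : n.-tuple bool,
    \sum_(w : n.-tuple bool) triangle ys (word u) (word v) (word w) * S w
    = S u * S v.

Definition exchange i c S (w : n.-tuple bool) : R :=
  S w - (bit_descent i w)%:R * c * S (swap_tuple i w).

(** The matrix acting on [S] is transposed onto the bottom side; [triangle_exchange] trades it for
    its action on the two other sides, where the hypothesis for the swapped parameters yields a
    product. *)
Lemma multiplicative_exchange i ys S :
  size ys = n -> (i.+1 < n)%N -> multiplicative (swap_at i ys) S ->
  multiplicative ys (exchange i (nth 0 ys i - nth 0 ys i.+1) S).
Proof.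
move=> szys lti multS u v; set c := _ - _.
transitivity (\sum_(w : n.-tuple bool)
    rmxT_at i c (triangle ys (word u) (word v)) (word w) * S w).
  rewrite /rmxT_at /exchange.
  under eq_bigr do rewrite mulrBr.
  under [RHS]eq_bigr do rewrite mulrBl.
  rewrite !big_split /= !sumrN; congr (_ - _).
  (* Reindexing by the swap performs the transposition: an ascent of a word is a descent of the
     swapped word. *)
  rewrite (reindex_inj (inv_inj (@swap_tupleK bool n i))).
  apply: eq_bigr => w _; rewrite swap_tupleK -map_swap_at.
  have -> : ascent i (word w) = bit_descent i (swap_at i w).
    rewrite -descent_word map_swap_at /descent /ascent.
    by rewrite !nth_swap_at // size_map size_tuple.
  by rewrite mulrCA mulrA.
have szw (t : n.-tuple bool) : size (word t) = size ys by rewrite size_map size_tuple szys.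
under eq_bigr => w _ do rewrite -triangle_exchange ?szw ?szys //.
have expand F (t : n.-tuple bool) :
  rmx_at i c F (word t) = F (word t) - (bit_descent i t)%:R * c * F (word (swap_tuple i t)).
  by rewrite /rmx_at descent_word -map_swap_at.
pose T (a b : n.-tuple bool) :=
  \sum_(w : n.-tuple bool) triangle (swap_at i ys) (word a) (word b) (word w) * S w.
transitivity (T u v - (bit_descent i v)%:R * c * T u (swap_tuple i v)
  - (bit_descent i u)%:R * c * (T (swap_tuple i u) v
    - (bit_descent i v)%:R * c * T (swap_tuple i u) (swap_tuple i v))).
  rewrite /T !mulr_sumr -!sumrB mulr_sumr -sumrB.
  by apply: eq_bigr => w _; rewrite !expand; ring.
rewrite /T !multS /exchange; ring.
Qed.

Lemma multiplicative_sorted ys (w0 : n.-tuple bool) :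
  size ys = n -> sorted implb w0 ->
  multiplicative ys (fun w => (w == w0)%:R).
Proof.
move=> szys sorted0 u v.
rewrite (bigD1 w0) //= big1 => [|w /negbTE->]; last by rewrite mulr0.
by rewrite eqxx mulr1 addr0 triangle_bottom_sorted ?size_tuple.
Qed.
End Eigenvectors.

(** Induction on the inversions of [k]. At a descent [i], the covector of the swapped word, taken
    for the swapped parameters, is exchanged. It vanishes at [k], so its new value there is its
    leading value times $-(y_i - y_{i+1})$, which is nonzero for distinct parameters. *)
Lemma multiplicative_triangular (R : idomainType) n (k : n.-tuple bool) (ys : seq R) :
  size ys = n -> uniq ys ->
  exists S, [/\ multiplicative ys S, S k != 0
    & forall w, S w != 0 -> w = k \/ (inversions w < inversions k)%N].
Proof.
move=> szys uys; have [N] := ubnP (inversions k).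
elim: N k ys szys uys => // N IH k ys szys uys ltN.
have [/hasP [i iT desc]|/hasPn nodesc] :=
    boolP (has (fun i => bit_descent i k) (iota 0 n.-1)); last first.
  have sortedk : sorted implb k.
    apply: sorted_no_descent => i; rewrite size_tuple => lti.
    by apply: nodesc; rewrite mem_iota; lia.
  exists (fun w => (w == k)%:R); split; first exact: multiplicative_sorted.
    by rewrite eqxx oner_eq0.
  by move=> w; case: (w =P k) => [->|_]; [left | rewrite eqxx].
have lti : (i.+1 < n)%N by move: iT; rewrite mem_iota; lia.
have invk := inversions_swap _ desc; rewrite size_tuple in invk.
have {}invk := invk lti.
have [|||S [multS Sk Ssupp]] := IH (swap_tuple i k) (swap_at i ys); last first.
- exists (exchange i (nth 0 ys i - nth 0 ys i.+1) S); split.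
  + exact: multiplicative_exchange.
  + have -> : exchange i (nth 0 ys i - nth 0 ys i.+1) S k
        = - ((nth 0 ys i - nth 0 ys i.+1) * S (swap_tuple i k)).
      rewrite /exchange desc mul1r; have -> : S k = 0; last by rewrite sub0r.
      have [//|/Ssupp[keq|/=]] := eqVneq (S k) 0; last by lia.
      by move: invk; rewrite {1}keq /=; lia.
    rewrite oppr_eq0 mulf_neq0 // subr_eq0 nth_uniq ?szys //; lia.
  + move=> w; have [Sw0|/Ssupp[->|]] := eqVneq (S w) 0; last first.
    * by move=> /= ltw _; right; lia.
    * by move=> _; right; rewrite /= invk.
    rewrite /exchange Sw0 sub0r oppr_eq0.
    (* A word that enters the support through the exchange has a descent at [i], hence exactly one
       inversion more than its swap, just as [k] does. *)
    have [descw|] := boolP (bit_descent i w); last by rewrite !mul0r eqxx.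
    rewrite mulf_eq0 negb_or => /andP[_ /Ssupp[/(inv_inj (@swap_tupleK _ _ i))|]].
      by left.
    have := inversions_swap _ descw; rewrite size_tuple => /(_ lti) -> /= ltw.
    by right; lia.
- by rewrite /=; lia.
- by rewrite (perm_uniq (perm_swap_at i ys)).
- by rewrite size_swap_at.
Qed.

Section Commutation.
Variable n : nat.

(** Each multiplicative [S] pairs with the product [C a b] to [S a * (S b * S x)], which is
    symmetric in [a] and [b]. Triangularity of these covectors separates the entries, by induction
    on the inversions of [w]. *)
Lemma triangle_commute_generic (R : idomainType) (ys : seq R) (u v w x : n.-tuple bool) :
  size ys = n -> uniq ys ->
  \sum_(y : n.-tuple bool) triangle ys (word u) (word y) (word w)
     * triangle ys (word v) (word x) (word y)
  = \sum_(y : n.-tuple bool) triangle ys (word v) (word y) (word w)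
     * triangle ys (word u) (word x) (word y).
Proof.
move=> szys uys.
pose C (a b w : n.-tuple bool) := \sum_(y : n.-tuple bool)
  triangle ys (word a) (word y) (word w) * triangle ys (word b) (word x) (word y).
have eigenC S a b : multiplicative ys S -> \sum_w C a b w * S w = S a * (S b * S x).
  move=> multS; rewrite -multS mulr_sumr.
  under eq_bigr do rewrite mulr_suml.
  rewrite exchange_big; apply: eq_bigr => y _ /=.
  rewrite mulrCA -multS mulr_sumr.
  by apply: eq_bigr => k _; ring.
suff : C u v w - C v u w = 0 by move=> /eqP; rewrite subr_eq0 => /eqP.
have [N] := ubnP (inversions w); elim: N w => // N IH w ltN.
have [S [multS Sw Ssupp]] := multiplicative_triangular w szys uys.
have : \sum_k (C u v k - C v u k) * S k = 0.
  under eq_bigr do rewrite mulrBl.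
  by rewrite sumrB !eigenC //; ring.
rewrite (bigD1 w) //= big1 ?addr0.
  by move=> /eqP; rewrite mulf_eq0 (negbTE Sw) orbF => /eqP.
move=> k ne; have [->|/Ssupp[eqk|ltk]] := eqVneq (S k) 0; first by rewrite mulr0.
  by rewrite eqk eqxx in ne.
by rewrite IH ?mul0r //; lia.
Qed.

(** With equal parameters the additional rhombus has weight 0, so only genuine puzzles are
    counted. *)
Definition triangle_puzzles (u v w : seq label) : int := triangle (nseq n 0) u v w.

Lemma triangle_commute (u v w x : n.-tuple bool) :
  \sum_(y : n.-tuple bool) triangle_puzzles (word u) (word y) (word w)
     * triangle_puzzles (word v) (word x) (word y)
  = \sum_(y : n.-tuple bool) triangle_puzzles (word v) (word y) (word w)
     * triangle_puzzles (word u) (word x) (word y).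
Proof.
(* These parameters are distinct, as their coefficients of $X$ are, and all of them vanish at $X =
   0$. *)
pose ys : seq {poly int} := [seq 'X *+ i | i <- iota 0 n].
have szys : size ys = n by rewrite size_map size_iota.
have uys : uniq ys.
  rewrite map_inj_uniq ?iota_uniq // => i j /(congr1 (fun p : {poly int} => p`_1)).
  rewrite !coefMn coefX /=; lia.
have eval0 a b c : triangle_puzzles a b c = horner_eval 0 (triangle ys a b c).
  rewrite triangle_rmorph /triangle_puzzles; congr triangle.
  apply: (@eq_from_nth _ 0); rewrite size_nseq ?size_map ?size_iota // => i lti.
  rewrite nth_nseq lti (nth_map 0) ?szys // (nth_map 0%N) ?size_iota //.
  by rewrite rmorphMn /= /horner_eval hornerX mul0rn.
under eq_bigr do rewrite !eval0 -rmorphM.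
under [RHS]eq_bigr do rewrite !eval0 -rmorphM.
by rewrite -!rmorph_sum (triangle_commute_generic _ _ _ _ szys uys).
Qed.
End Commutation.

(** * Sums over labellings of a list of edges *)

Section LabelSums.
Variables (T : eqType) (R : comNzRingType).
Implicit Types (E D : seq T) (L : T -> label) (Phi : (T -> label) -> R).

Definition relabel L e l : T -> label := fun e' => if e' == e then l else L e'.

(** Labellings are total functions, [L] supplying the labels off [E], so that sums over different
    sets of edges can be nested. *)
Fixpoint label_sum E L Phi : R :=
  if E is e :: E' then \sum_l label_sum E' (relabel L e l) Phi else Phi L.

Definition depends_on (D : pred T) Phi : Prop :=
  forall L1 L2, (forall e, D e -> L1 e = L2 e) -> Phi L1 = Phi L2.

Lemma label_sum_cat E1 E2 L Phi :
  label_sum (E1 ++ E2) L Phi = label_sum E1 L (fun L1 => label_sum E2 L1 Phi).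
Proof. by elim: E1 L => //= e E1 IH L; apply: eq_bigr => l _. Qed.

Lemma eq_label_sum E L Phi1 Phi2 :
  (forall L1, (forall e, e \notin E -> L1 e = L e) -> Phi1 L1 = Phi2 L1) ->
  label_sum E L Phi1 = label_sum E L Phi2.
Proof.
elim: E L => [|e E IH] L eqPhi /=; first by apply: eqPhi.
apply: eq_bigr => l _; apply: IH => L1 eqL1; apply: eqPhi => e'.
by rewrite inE negb_or => /andP[/negbTE ne nE]; rewrite eqL1 // /relabel ne.
Qed.

Lemma label_sum_mull E L c Phi :
  label_sum E L (fun L1 => c * Phi L1) = c * label_sum E L Phi.
Proof. by elim: E L => //= e E IH L; rewrite mulr_sumr; apply: eq_bigr => l _. Qed.

Lemma label_sum_depends (D : pred T) E Phi L1 L2 :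
  depends_on D Phi -> (forall e, D e -> e \notin E -> L1 e = L2 e) ->
  label_sum E L1 Phi = label_sum E L2 Phi.
Proof.
move=> dep; elim: E L1 L2 => [|e E IH] L1 L2 eqL /=.
  by apply: dep => e De; apply: eqL.
apply: eq_bigr => l _; apply: IH => e' De' nE; rewrite /relabel.
by case: eqP => // /eqP ne; apply: eqL => //; rewrite inE negb_or ne.
Qed.

Lemma label_sum_pull E L Phi1 Phi2 (D : pred T) :
  depends_on D Phi1 -> {in E, forall e, ~~ D e} ->
  label_sum E L (fun L1 => Phi1 L1 * Phi2 L1) = Phi1 L * label_sum E L Phi2.
Proof.
move=> dep disj; rewrite -label_sum_mull; apply: eq_label_sum => L1 eqL1.
congr (_ * _); apply: dep => e De; apply: eqL1.
by apply/negP => /disj; rewrite De.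
Qed.

(** Independence of the sectors once the spokes are fixed: among the summed edges, [Phi k] reads
    only those of [E k], while edges that are not summed may be shared. *)
Lemma label_sum_prod (K : eqType) (ks : seq K) (E : K -> seq T) (D : K -> pred T)
    (Phi : K -> (T -> label) -> R) L :
  uniq ks -> (forall k, k \in ks -> depends_on (D k) (Phi k)) ->
  (forall j k, j \in ks -> k \in ks -> j != k -> {in E j, forall e, ~~ D k e}) ->
  label_sum (flatten (map E ks)) L (fun L1 => \prod_(k <- ks) Phi k L1)
  = \prod_(k <- ks) label_sum (E k) L (Phi k).
Proof.
elim: ks L => [|k ks IH] L /=; first by rewrite !big_nil.
move=> /andP[nk uks] dep disj; rewrite label_sum_cat big_cons.
have disj' j : j \in ks -> j != k.
  by move=> jks; apply: contraNneq nk => <-.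
rewrite [RHS]mulrC -label_sum_mull; apply: eq_label_sum => L1 eqL1.
transitivity (label_sum (flatten (map E ks)) L1
    (fun L2 => Phi k L2 * \prod_(j <- ks) Phi j L2)).
  by apply: eq_label_sum => L2 _; rewrite big_cons.
rewrite (label_sum_pull _ _ (dep k (mem_head _ _))); last first.
  move=> e /flatten_mapP[j jks]; apply: disj; rewrite ?inE ?eqxx ?jks ?orbT //.
  exact: disj'.
rewrite mulrC IH //; last 2 first.
- by move=> j jks; apply: dep; rewrite inE jks orbT.
- by move=> i j iks jks; apply: disj; rewrite inE ?iks ?jks orbT.
congr (_ * _); rewrite [LHS]big_seq [RHS]big_seq; apply: eq_bigr => j jks.
apply: (label_sum_depends (dep j _)) => [|e De _]; first by rewrite inE jks orbT.
apply: eqL1.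
apply/negP => eEk; suff /(_ e eEk) : {in E k, forall e, ~~ D j e} by rewrite De.
by apply: disj; rewrite ?inE ?eqxx ?jks ?orbT // eq_sym disj'.
Qed.

Lemma sum_cons_tuple n (F : n.+1.-tuple label -> R) :
  \sum_(t : n.+1.-tuple label) F t = \sum_l \sum_(t : n.-tuple label) F [tuple of l :: t].
Proof.
rewrite pair_big /=.
rewrite (reindex (fun p : label * n.-tuple label => [tuple of p.1 :: p.2])) //=.
exists (fun t => (thead t, [tuple of behead t])) => [[l t] _|t _] /=.
  by congr pair; apply: val_inj.
by rewrite [RHS]tuple_eta; apply: val_inj.
Qed.

Lemma label_sum_word n E L (F : seq label -> R) :
  uniq E -> size E = n ->
  label_sum E L (fun L1 => F (map L1 E)) = \sum_(t : n.-tuple label) F t.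
Proof.
elim: E n L F => [|e E IH] n L F /=.
  move=> _ <-; rewrite (bigD1 [tuple]) //= big1 ?addr0 // => t /eqP[].
  exact: tuple0.
move=> /andP[ne uE]; case: n => // n [szE].
rewrite sum_cons_tuple; apply: eq_bigr => l _ /=.
rewrite -(IH n (relabel L e l) (fun t => F (l :: t))) //.
apply: eq_label_sum => L1 ->; last exact: ne.
by rewrite /relabel eqxx.
Qed.

Fixpoint word_sum n k (F : seq (seq label) -> R) : R :=
  if k is k'.+1 then \sum_(t : n.-tuple label) word_sum n k' (fun ts => F (tval t :: ts))
  else F [::].

Lemma label_sum_words n (Es : seq (seq T)) L (F : seq (seq label) -> R) :
  uniq (flatten Es) -> all (fun E => size E == n) Es ->
  label_sum (flatten Es) L (fun L1 => F [seq map L1 E | E <- Es])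
  = word_sum n (size Es) F.
Proof.
elim: Es L F => //= E Es IH L F; rewrite cat_uniq => /and3P[uE disj uEs] /andP[/eqP szE allE].
rewrite label_sum_cat.
transitivity (label_sum E L (fun L1 => word_sum n (size Es) (fun ts => F (map L1 E :: ts)))).
  apply: eq_label_sum => L1 _; rewrite -(IH L1) //; apply: eq_label_sum => L2 eqL2.
  congr (F (_ :: _)); apply/eq_in_map => e eE; apply: eqL2.
  by apply: contra disj => eEs; apply/hasP; exists e.
exact: (label_sum_word L (fun t => word_sum n (size Es) (fun ts => F (t :: ts)))).
Qed.

End LabelSums.

(** Brings the sum over a rotated sector back to the reference sector. *)
Lemma label_sum_image (T T' : eqType) (R : comNzRingType) (r : T' -> T) (E : seq T')
    (L : T -> label) (Phi : (T' -> label) -> R) :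
  injective r -> depends_on predT Phi ->
  label_sum (map r E) L (fun L1 => Phi (L1 \o r)) = label_sum E (L \o r) Phi.
Proof.
move=> injr ext; elim: E L => //= e E IH L; apply: eq_bigr => l _; rewrite IH.
apply: (label_sum_depends ext) => e' _ _.
by rewrite /relabel /= (inj_eq injr).
Qed.

Definition total_label (S : seq point) (P : labelling S) : edge -> label :=
  fun e => odflt L0 (edge_label P e).

Lemma sum_labelling (R : comNzRingType) (S : seq point) (Phi : (edge -> label) -> R) (E : seq edge) :
  depends_on predT Phi -> uniq E -> E =i edges S ->
  \sum_(P : labelling S) Phi (total_label P) = label_sum E (fun=> L0) Phi.
Proof.
move=> ext uE memE.
pose s : seq (seq_sub (edges S)) := pmap insub E.
have mapE : map val s = E.
  rewrite /s pmap_filter; last exact: insubK.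
  by apply/all_filterP/allP => e; rewrite memE isSome_insub.
have us : uniq s by rewrite -(map_inj_uniq val_inj) mapE.
have mems x : x \in s by rewrite -(mem_map val_inj) mapE memE (valP x).
(* Generalized to labellings that agree with [P0] off [s'], so that the induction can free one edge
   at a time. *)
have gen (s' : seq (seq_sub (edges S))) (P0 : labelling S) : uniq s' ->
  \sum_(P : labelling S | [forall x, (x \notin s') ==> (P x == P0 x)]) Phi (total_label P)
  = label_sum (map val s') (total_label P0) Phi.
  elim: s' P0 => [|x s' IH] P0 /=.
    move=> _; rewrite (big_pred1 P0) // => P /=.
    apply/forallP/eqP => [eqP0|-> x]; last by rewrite eqxx ?implybT.
    by apply/ffunP => x; apply/eqP; have := eqP0 x.
  move=> /andP[nx us'].
  rewrite (partition_big (fun P : labelling S => P x) predT) //=.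
  apply: eq_bigr => l _.
  pose P1 : labelling S := [ffun y => if y == x then l else P0 y].
  transitivity (label_sum (map val s') (total_label P1) Phi); last first.
    apply: (label_sum_depends ext) => e _ _; rewrite /total_label /edge_label /relabel.
    case: insubP => [y _ <-|ne] /=; first by rewrite ffunE (inj_eq val_inj).
    by case: eqP => // ex; rewrite ex (valP x) in ne.
  rewrite -IH //; apply: eq_bigl => P.
  apply/andP/forallP => [[/forallP eqP0 /eqP Px] y|eqP1].
    rewrite ffunE; case: (y =P x) => [->|/eqP ne]; first by rewrite Px eqxx ?implybT.
    by have := eqP0 y; rewrite inE negb_or ne.
  split; last by have := eqP1 x; rewrite nx ffunE eqxx.
  apply/forallP => y; rewrite inE negb_or; apply/implyP => /andP[ne ny].
  by have := eqP1 y; rewrite ny ffunE (negbTE ne).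
have := gen s [ffun=> L0] us; rewrite mapE => gens.
transitivity (\sum_(P : labelling S | [forall x, (x \notin s) ==> (P x == [ffun=> L0] x)])
    Phi (total_label P)).
  by apply: eq_bigl => P; symmetry; apply/forallP => x; rewrite mems.
rewrite gens; apply: (label_sum_depends ext) => e _ _.
by rewrite /total_label /edge_label; case: insub => //= y; rewrite ffunE.
Qed.

(** * Puzzles on a sector of the hexagon *)

Section Geometry.
Implicit Types (X x y : int) (n m i j : nat) (L : edge -> label) (e : edge).

Lemma edge_eqE x y d x' y' d' :
  (((x, y), d) == ((x', y'), d') :> edge) = [&& x == x', y == y' & d == d'].
Proof. by rewrite !xpair_eqE andbA. Qed.

Lemma dir_eqE :
  (((D0 == D60) = false) * ((D0 == D120) = false) * ((D60 == D0) = false) *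
   ((D60 == D120) = false) * ((D120 == D0) = false) * ((D120 == D60) = false))%type.
Proof. by []. Qed.

(* The sector of size [n] used below is the upward triangle with vertices [(-n, 0)],
   [(-n, n)] and [(0, 0)], whose left side is the NW side of the hexagon of side [n]. *)
Definition up_ok L x y : bool :=
  allowed_piece (L ((x, y), D60)) (L ((x + 1, y), D120)) (L ((x, y), D0)).

Definition down_ok L x y : bool :=
  allowed_piece (L ((x - 1, y + 1), D0)) (L ((x, y), D60)) (L ((x, y), D120)).

Definition rising X j m : seq edge := [seq ((X, i%:Z), D60) | i <- iota j m].

(** The rhombi between the lines $x = X - 1$ and $x = X$, topmost first as in [pass]; each
    contributes its horizontal diagonal and its two outgoing edges. *)
Fixpoint strip X m j : seq edge :=
  if m is m'.+1 then
    strip X m' j.+1 ++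
      [:: ((X - 1, j.+1%:Z), D0); ((X, j%:Z), D60); ((X, j%:Z), D120)]
  else [::].

Fixpoint strip_ok L X m j : bool :=
  if m is m'.+1 then
    [&& strip_ok L X m' j.+1, up_ok L (X - 1) j.+1%:Z & down_ok L X j%:Z]
  else true.

Fixpoint bottom_side n : seq edge :=
  if n is n'.+1 then ((- n'%:Z - 1, 0), D0) :: bottom_side n' else [::].

Fixpoint right_side n : seq edge :=
  if n is n'.+1 then ((- n'%:Z, n'%:Z), D120) :: right_side n' else [::].

Definition left_side n : seq edge := rising (- n%:Z) 0 n.

Fixpoint inner_edges n : seq edge :=
  if n is n'.+1 then strip (- n'%:Z) n' 0 ++ inner_edges n' else [::].

Fixpoint triangle_ok L n : bool :=
  if n is n'.+1 then
    [&& up_ok L (- n'%:Z - 1) 0, strip_ok L (- n'%:Z) n' 0 & triangle_ok L n']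
  else true.

Lemma mem_rising X j m (p : point) d :
  ((p, d) \in rising X j m) =
  [&& d == D60, p.1 == X, j%:Z <= p.2 & p.2 < (j + m)%:Z].
Proof.
apply/mapP/and4P => [[i]|[/eqP-> /eqP<- le lt]].
  by rewrite mem_iota => iP [-> ->] /=; split=> //; lia.
case: p le lt => x y /= le lt; exists `|y|%N; first by rewrite mem_iota; lia.
by rewrite gez0_abs //; lia.
Qed.

Lemma mem_strip X m j x y d :
  (((x, y), d) \in strip X m j) =
  match d with
  | D0 => [&& x == X - 1, j%:Z + 1 <= y & y <= (j + m)%:Z]
  | _ => [&& x == X, j%:Z <= y & y < (j + m)%:Z]
  end.
Proof.
elim: m j => [|m IH] j /=; first by rewrite in_nil; case: d; lia.
rewrite mem_cat IH !inE !edge_eqE.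
case: d {IH} => /=; rewrite ?dir_eqE ?eqxx ?andbF ?andbT /=; lia.
Qed.

Lemma mem_bottom_side n x y d :
  (((x, y), d) \in bottom_side n) = [&& d == D0, y == 0, - n%:Z <= x & x <= -1].
Proof.
elim: n => [|n IH] /=; first by rewrite in_nil; case: d => /=; rewrite ?dir_eqE ?eqxx ?andbF ?andbT /=; lia.
rewrite inE IH !edge_eqE; case: d {IH} => /=; rewrite ?dir_eqE ?eqxx ?andbF ?andbT /=; lia.
Qed.

Lemma mem_right_side n x y d :
  (((x, y), d) \in right_side n) = [&& d == D120, x + y == 0, 0 <= y & y < n%:Z].
Proof.
elim: n => [|n IH] /=; first by rewrite in_nil; case: d => /=; rewrite ?dir_eqE ?eqxx ?andbF ?andbT /=; lia.
rewrite inE IH !edge_eqE; case: d {IH} => /=; rewrite ?dir_eqE ?eqxx ?andbF ?andbT /=; lia.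
Qed.

Lemma mem_inner_edges n x y d :
  (((x, y), d) \in inner_edges n) =
  match d with
  | D0 => [&& - n%:Z <= x, 1 <= y & x + y <= -1]
  | D60 => [&& - n%:Z + 1 <= x, 0 <= y & x + y <= -1]
  | D120 => [&& - n%:Z + 1 <= x, 0 <= y & x + y <= -1]
  end.
Proof.
elim: n => [|n IH] /=; first by rewrite in_nil; case: d => /=; rewrite ?dir_eqE ?eqxx ?andbF ?andbT /=; lia.
rewrite mem_cat IH mem_strip; case: d {IH} => /=; rewrite ?dir_eqE ?eqxx ?andbF ?andbT /=; lia.
Qed.

Lemma uniq_strip X m j : uniq (strip X m j).
Proof.
elim: m j => //= m IH j; rewrite cat_uniq IH /= !inE !edge_eqE.
rewrite !mem_strip ?dir_eqE ?eqxx ?andbF ?andbT /=. lia.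
Qed.

Lemma uniq_inner_edges n : uniq (inner_edges n).
Proof.
elim: n => //= n IH; rewrite cat_uniq IH uniq_strip andbT /=.
apply/hasPn => -[[x y] d]; rewrite mem_inner_edges mem_strip.
case: d; lia.
Qed.

Lemma uniq_rising X j m : uniq (rising X j m).
Proof. by rewrite map_inj_uniq ?iota_uniq // => i k [] /= []; lia. Qed.

Lemma uniq_bottom_side n : uniq (bottom_side n).
Proof. by elim: n => //= n ->; rewrite mem_bottom_side; lia. Qed.

Lemma size_bottom_side n : size (bottom_side n) = n.
Proof. by elim: n => //= n ->. Qed.

Lemma size_rising X j m : size (rising X j m) = m.
Proof. by rewrite size_map size_iota. Qed.

Lemma strip_ok_depends L1 L2 X m j :
  (forall x y d, (if d is D0 then x <= X - 1 else x <= X) ->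
     (if d is D0 then j%:Z + 1 <= y else j%:Z <= y) ->
     L1 ((x, y), d) = L2 ((x, y), d)) ->
  strip_ok L1 X m j = strip_ok L2 X m j.
Proof.
elim: m j => //= m IH j eqL.
rewrite (IH j.+1); last by move=> x y d xX yj; apply: eqL; case: d xX yj; lia.
congr [&& _, _ & _]; first by rewrite /up_ok !eqL //; lia.
rewrite /down_ok !eqL //; lia.
Qed.

(** Each rhombus of the strip is a crossing of parameter 0, and its diagonal carries the label
    summed inside [crossing]. *)
Lemma strip_sum X m j L (K : seq label -> label -> int) :
  label_sum (strip X m j) L (fun L1 =>
    (strip_ok L1 X m j)%:R * K (map L1 (rising X j m)) (L1 ((X, j%:Z), D120)))
  = pass 0 (nseq m 0) (map L (rising (X - 1) j.+1 m)) (L ((X, (j + m)%:Z), D120)) K.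
Proof.
elim: m j K => [|m IH] j K; first by rewrite /= mul1r addn0.
rewrite [strip _ _ _]/= label_sum_cat.
have -> : (j + m.+1)%N = (j.+1 + m)%N by rewrite addnS.
rewrite [RHS]/= -IH; apply: eq_label_sum => L1 eqL1.
have <- : L1 ((X - 1, j.+1%:Z), D60) = L ((X - 1, j.+1%:Z), D60).
  by rewrite eqL1 // mem_strip; lia.
(* The strip sums over the diagonal first and [pass] over it last, hence the two exchanges of
   sums. *)
rewrite mulr_sumr [LHS]exchange_big; apply: eq_bigr => g _.
rewrite mulr_sumr [LHS]exchange_big; apply: eq_bigr => s _.
rewrite /crossing subrr mulr0 addr0 mulr_suml mulr_sumr; apply: eq_bigr => h _.
set L4 := relabel _ _ s.
have offL4 x y d : ~~ [&& x == X - 1, y == j.+1%:Z & d == D0] ->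
    ~~ [&& x == X, y == j%:Z & d == D60] -> ~~ [&& x == X, y == j%:Z & d == D120] ->
    L4 ((x, y), d) = L1 ((x, y), d).
  by rewrite /L4 /relabel !edge_eqE => /negbTE-> /negbTE-> /negbTE->.
have L4s : L4 ((X, j%:Z), D120) = s by rewrite /L4 /relabel eqxx.
have L4g : L4 ((X, j%:Z), D60) = g.
  by rewrite /L4 /relabel !edge_eqE !eqxx dir_eqE.
have L4h : L4 ((X - 1, j.+1%:Z), D0) = h.
  by rewrite /L4 /relabel !edge_eqE !eqxx !dir_eqE !andbF.
rewrite /= L4s L4g.
have -> : strip_ok L4 X m j.+1 = strip_ok L1 X m j.+1.
  apply: strip_ok_depends => x y d xX yj; apply: offL4.
  - by case: d xX yj => *; rewrite ?dir_eqE ?eqxx; lia.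
  - by case: d xX yj => *; rewrite ?dir_eqE ?eqxx; lia.
  - by case: d xX yj => *; rewrite ?dir_eqE ?eqxx; lia.
have -> : map L4 (rising X j.+1 m) = map L1 (rising X j.+1 m).
  apply/eq_in_map => -[[x y] d]; rewrite mem_rising => /and4P[/= /eqP-> /eqP-> yj _].
  by apply: offL4; rewrite ?dir_eqE ?eqxx; lia.
have -> : up_ok L4 (X - 1) j.+1 = allowed_piece (L1 ((X - 1, j.+1%:Z), D60)) (L1 ((X, j.+1%:Z), D120)) h.
  rewrite /up_ok L4h subrK !offL4 ?dir_eqE ?eqxx //; lia.
have -> : down_ok L4 X j = allowed_piece h g s.
  have e : (j%:Z + 1 = j.+1%:Z)%R by lia.
  by rewrite /down_ok e L4h L4s L4g.
by rewrite /piece -!mulnb !natrM -!mulrA.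
Qed.

(** Both recursions remove the strip along the left side. The smaller sector keeps its corner at the
    origin, so its edges keep their names. *)
Lemma triangle_sum n L :
  label_sum (inner_edges n) L (fun L1 => (triangle_ok L1 n)%:R)
  = triangle_puzzles n (map L (left_side n)) (map L (right_side n)) (map L (bottom_side n)).
Proof.
elim: n L => [|n IH] L; first by [].
rewrite [inner_edges _]/= label_sum_cat /triangle_puzzles.
have -> : left_side n.+1 = ((- n%:Z - 1, 0), D60) :: rising (- n%:Z - 1) 1 n.
  by rewrite /left_side /rising /=; have -> : - n.+1%:Z = - n%:Z - 1 by lia.
rewrite [right_side _]/= [bottom_side _]/= [nseq _ _]/= triangle_cons.
have := strip_sum (- n%:Z) n 0 L (fun hs s =>
  piece int (L ((- n%:Z - 1, 0), D60)) s (L ((- n%:Z - 1, 0), D0))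
  * triangle (nseq n 0) hs (map L (right_side n)) (map L (bottom_side n))).
rewrite add0n => <-; apply: eq_label_sum => L1 eqL1.
have -> : map L (right_side n) = map L1 (right_side n).
  apply/eq_in_map => -[[x y] d]; rewrite mem_right_side => mem; rewrite eqL1 //.
  by rewrite mem_strip; case: d mem => /=; lia.
have -> : map L (bottom_side n) = map L1 (bottom_side n).
  apply/eq_in_map => -[[x y] d]; rewrite mem_bottom_side => mem; rewrite eqL1 //.
  by rewrite mem_strip; case: d mem => /=; rewrite ?dir_eqE; lia.
rewrite -/(triangle_puzzles n _ _ _) -/(left_side n) -IH !mulrA -label_sum_mull.
apply: eq_label_sum => L2 eqL2.
rewrite [triangle_ok _ _]/= -!mulnb !natrM mulrA; congr (_ * _).
rewrite mulrC; congr (_%:R * _%:R).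
- congr nat_of_bool; apply: strip_ok_depends => x y d xX yj; apply: eqL2.
  by rewrite mem_inner_edges; case: d xX yj => /=; lia.
- congr nat_of_bool; rewrite /up_ok subrK.
  have e d : L2 ((- n%:Z - 1, 0), d) = L ((- n%:Z - 1, 0), d).
    rewrite eqL2 ?eqL1 // ?mem_strip ?mem_inner_edges; case: d; lia.
  by rewrite !e eqL2 // mem_inner_edges; lia.
Qed.

Definition side_triangle_ok n (w : seq bool) L : int :=
  (map L (left_side n) == word w)%:R * (triangle_ok L n)%:R.

Lemma side_triangle_sum n (w : n.-tuple bool) L :
  label_sum (left_side n ++ inner_edges n) L (side_triangle_ok n w)
  = triangle_puzzles n (word w) (map L (right_side n)) (map L (bottom_side n)).
Proof.
rewrite label_sum_cat.
pose F v := (v == word w)%:R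
  * triangle_puzzles n v (map L (right_side n)) (map L (bottom_side n)).
transitivity (label_sum (left_side n) L (fun L1 => F (map L1 (left_side n)))).
  rewrite /F; apply: eq_label_sum => L1 eqL1 /=.
  have -> : map L (right_side n) = map L1 (right_side n).
    apply/eq_in_map => -[[x y] d]; rewrite mem_right_side => mem; rewrite eqL1 //.
    by rewrite mem_rising; case: d mem => /=; rewrite ?dir_eqE; lia.
  have -> : map L (bottom_side n) = map L1 (bottom_side n).
    apply/eq_in_map => -[[x y] d]; rewrite mem_bottom_side => mem; rewrite eqL1 //.
    by rewrite mem_rising; case: d mem => /=; rewrite ?dir_eqE; lia.
  rewrite -triangle_sum -label_sum_mull; apply: eq_label_sum => L2 eqL2.
  rewrite /side_triangle_ok; congr ((_ == _)%:R * _).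
  apply/eq_in_map => -[[x y] d]; rewrite mem_rising => /and4P[/= /eqP-> /eqP-> y0 ltyn].
  by apply: eqL2; rewrite mem_inner_edges; lia.
rewrite (label_sum_word L F (uniq_rising _ _ _) (size_rising _ _ _)) /F.
rewrite (bigD1 [tuple of word w]) //= big1 ?addr0 ?eqxx ?mul1r // => t ne.
by rewrite -[_ == _]/(t == [tuple of word w]) (negbTE ne) mul0r.
Qed.

(** * Rotations of the hexagon *)

(* The clockwise rotation by 60 degrees about the origin. *)
Definition turn e : edge :=
  let: ((x, y), d) := e in
  match d with
  | D0 => ((x + y + 1, - x - 1), D120)
  | D60 => ((x + y, - x), D0)
  | D120 => ((x + y, - x), D60)
  end.

Lemma turn6 e : iter 6 turn e = e.
Proof. by case: e => [[x y] []] /=; congr ((_, _), _); lia. Qed.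

Lemma iter_turn_inj k : injective (iter k turn).
Proof.
have turn_inj : injective turn.
  by move=> e1 e2 eq; rewrite -(turn6 e1) -(turn6 e2) !iterSr eq.
by elim: k => [|k IH] e1 e2 //= /turn_inj /IH.
Qed.

Lemma mem_iter_turn k e S : (k <= 6)%N ->
  (e \in map (iter k turn) S) = (iter (6 - k) turn e \in S).
Proof.
move=> k6; rewrite -{1}(turn6 e) -{1}(subnKC k6) iterD mem_map //.
exact: iter_turn_inj.
Qed.

(* The boolean is [true] for upward triangles; the point is the lowest vertex, the
   left one if there are two. *)
Definition unit_triangle : Type := bool * point.

Definition tri_ok L (t : unit_triangle) : bool :=
  if t.1 then up_ok L t.2.1 t.2.2 else down_ok L t.2.1 t.2.2.

Definition turn_tri (t : unit_triangle) : unit_triangle :=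
  if t.1 then (false, (t.2.1 + t.2.2 + 1, - t.2.1 - 1))
  else (true, (t.2.1 + t.2.2, - t.2.1)).

Lemma turn_tri6 t : iter 6 turn_tri t = t.
Proof. by case: t => [[] [x y]] /=; congr (_, (_, _)); rewrite /=; lia. Qed.

Lemma allowed_pieceC (a b c : label) : allowed_piece a b c = allowed_piece b c a.
Proof. by case: a; case: b; case: c. Qed.

Lemma tri_ok_turn L t : tri_ok (L \o turn) t = tri_ok L (turn_tri t).
Proof.
case: t => [[] [x y]]; rewrite /tri_ok /= /up_ok /down_ok /=.
  by congr (allowed_piece (L (_, _, _)) (L (_, _, _)) (L (_, _, _))); lia.
(* The top, right and left edges of a downward triangle become the right, bottom and left edges of
   an upward one, a cyclic shift of the chosen order. *)
rewrite allowed_pieceC [RHS]allowed_pieceC [RHS]allowed_pieceC.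
by congr (allowed_piece (L (_, _, _)) (L (_, _, _)) (L (_, _, _))); lia.
Qed.

Lemma tri_ok_iter_turn L k t : tri_ok (L \o iter k turn) t = tri_ok L (iter k turn_tri t).
Proof.
elim: k L t => [|k IH] L t; first by case: t => [[] p].
rewrite iterS -tri_ok_turn -IH.
by case: t => [[] p].
Qed.

(** * Covering the hexagon by six rotated sectors *)

Definition in_sector n (t : unit_triangle) : bool :=
  [&& (if t.1 then - n%:Z <= t.2.1 else - n%:Z + 1 <= t.2.1), 0 <= t.2.2
    & t.2.1 + t.2.2 <= -1].

Definition in_hexagon n (t : unit_triangle) : bool :=
  if t.1 then
    [&& - n%:Z <= t.2.1, t.2.1 < n%:Z, - n%:Z <= t.2.2, t.2.2 < n%:Z,
        - n%:Z <= t.2.1 + t.2.2 & t.2.1 + t.2.2 < n%:Z]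
  else
    [&& - n%:Z < t.2.1, t.2.1 <= n%:Z, - n%:Z <= t.2.2, t.2.2 < n%:Z,
        - n%:Z <= t.2.1 + t.2.2 & t.2.1 + t.2.2 < n%:Z].

Lemma strip_okP L X m j :
  reflect (forall y, (j%:Z + 1 <= y <= (j + m)%:Z -> up_ok L (X - 1) y)
      /\ (j%:Z <= y < (j + m)%:Z -> down_ok L X y))
    (strip_ok L X m j).
Proof.
elim: m j => [|m IH] j /=; first by constructor=> y; split; lia.
apply: (iffP and3P) => [[/IH okP up down] y|ok].
  split=> yj.
    have [->//|ne] := eqVneq y j.+1%:Z; apply: (okP y).1; lia.
  have [->//|ne] := eqVneq y j%:Z; apply: (okP y).2; lia.
split; last by apply: (ok _).2; lia.
  by apply/IH => y; split=> yj; [apply: (ok y).1 | apply: (ok y).2]; lia.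
by apply: (ok _).1; lia.
Qed.

Lemma triangle_okP L n :
  reflect (forall t, in_sector n t -> tri_ok L t) (triangle_ok L n).
Proof.
elim: n => [|n IH] /=.
  by constructor=> -[[] [x y]]; rewrite /in_sector /=; lia.
apply: (iffP and3P) => [[up /strip_okP strip /IH ok] [b [x y]] sec|ok].
  have [/ok//|nsec] := boolP (in_sector n (b, (x, y))).
  rewrite /tri_ok; case: b sec nsec; rewrite /in_sector /= => sec nsec.
    have -> : x = - n%:Z - 1 by lia.
    have [->//|ne] := eqVneq y 0; apply: (strip y).1; lia.
  have -> : x = - n%:Z by lia.
  by apply: (strip y).2; lia.
split.
- by apply: (ok (true, (- n%:Z - 1, 0))); rewrite /in_sector /=; lia.
- apply/strip_okP => y; split=> yn.
    by apply: (ok (true, (- n%:Z - 1, y))); rewrite /in_sector /=; lia.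
  by apply: (ok (false, (- n%:Z, y))); rewrite /in_sector /=; lia.
- by apply/IH => -[[] [x y]] sec; apply: ok; move: sec; rewrite /in_sector /=; lia.
Qed.

Lemma sector_cover n t : in_hexagon n t ->
  exists2 k, (k < 6)%N & in_sector n (iter (6 - k) turn_tri t).
Proof.
move=> hex.
have : [|| in_sector n (iter 6 turn_tri t), in_sector n (iter 5 turn_tri t),
   in_sector n (iter 4 turn_tri t), in_sector n (iter 3 turn_tri t),
   in_sector n (iter 2 turn_tri t) | in_sector n (iter 1 turn_tri t)].
  by move: hex; case: t => [[] [x y]]; rewrite /in_hexagon /in_sector /=; lia.
by move=> /or4P[?|?|?|/or3P[?|?|?]];
  [exists 0%N|exists 1%N|exists 2%N|exists 3%N|exists 4%N|exists 5%N].
Qed.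

Lemma sector_in_hexagon n t k : (k < 6)%N ->
  in_sector n t -> in_hexagon n (iter k turn_tri t).
Proof.
case: t => [[] [x y]]; move: k => [|[|[|[|[|[|k]]]]]] // _;
  rewrite /in_hexagon /in_sector /=; lia.
Qed.

Lemma hexagon_okP L n :
  (forall t, in_hexagon n t -> tri_ok L t)
  <-> (forall k, (k < 6)%N -> triangle_ok (L \o iter k turn) n).
Proof.
split=> [ok k k6|ok t /sector_cover[k k6 sec]].
  apply/triangle_okP => t sec; rewrite tri_ok_iter_turn.
  by apply: ok; apply: sector_in_hexagon.
have /triangle_okP/(_ _ sec) := ok k k6.
by rewrite tri_ok_iter_turn -iterD subnKC ?turn_tri6 // ltnW.
Qed.

Lemma total_label_val (S : seq point) (P : labelling S) (e : seq_sub (edges S)) :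
  total_label P (val e) = P e.
Proof. by rewrite /total_label /edge_label valK. Qed.

Lemma edge_label_total (S : seq point) (P : labelling S) e :
  e \in edges S -> edge_label P e = Some (total_label P e).
Proof. by move=> eS; rewrite /total_label /edge_label insubT. Qed.

Lemma up_triangleE x y :
  up_triangle (x, y) = (((x, y), D60), ((x + 1, y), D120), ((x, y), D0)).
Proof. by rewrite /up_triangle; congr (_, (_, _, _), _); rewrite ?addr0. Qed.

Lemma down_triangleE x y :
  down_triangle (x, y) = (((x - 1, y + 1), D0), ((x, y), D60), ((x, y), D120)).
Proof. by []. Qed.

Lemma mem_edges_hexagon n x y d :
  (((x, y), d) \in edges (hexagon n)) =
  [&& - n%:Z <= x, x <= n%:Z, - n%:Z <= y, y <= n%:Z, - n%:Z <= x + y, x + y <= n%:Z &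
    match d with
    | D0 => (x < n%:Z) && (x + y < n%:Z)
    | D60 => (y < n%:Z) && (x + y < n%:Z)
    | D120 => (- n%:Z < x) && (y < n%:Z)
    end].
Proof. by rewrite mem_edges !mem_hexagon; case: d => /=; lia. Qed.

Lemma all_pieces_allowedP n (P : labelling (hexagon n)) :
  reflect (forall t, in_hexagon n t -> tri_ok (total_label P) t) (all_pieces_allowed P).
Proof.
apply: (iffP idP) => [/forallP ok [b [x y]] hex|ok].
  have ok3 e f g : e \in edges (hexagon n) -> f \in edges (hexagon n) ->
      g \in edges (hexagon n) -> is_triangle e f g ->
      allowed_piece (total_label P e) (total_label P f) (total_label P g).
    move=> eE fE gE tri.
    have /forallP/(_ (SeqSub fE))/forallP/(_ (SeqSub gE)) := ok (SeqSub eE).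
    by rewrite -!total_label_val /= tri.
  move: hex; rewrite /in_hexagon /tri_ok; case: b => /= hex.
    apply: ok3; rewrite ?mem_edges_hexagon; try lia.
    by apply/is_triangleP; exists (x, y); left; rewrite up_triangleE.
  apply: ok3; rewrite ?mem_edges_hexagon; try lia.
  by apply/is_triangleP; exists (x, y); right.
apply/forallP => e; apply/forallP => f; apply/forallP => g.
apply/implyP => /is_triangleP[[x y]]; rewrite up_triangleE down_triangleE -!total_label_val.
have := valP e; have := valP f; have := valP g => + + +.
move=> gE fE eE [] [ee ef eg]; move: gE fE eE; rewrite /= ee ef eg !mem_edges_hexagon => gE fE eE.
  by apply: (ok (true, (x, y))); rewrite /in_hexagon /=; lia.
by apply: (ok (false, (x, y))); rewrite /in_hexagon /=; lia.
Qed.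

(** The order starts with NW, the side lying in the reference sector; side [k] then lies in the
    sector rotated [k] times. *)
Definition side_at k : side := nth SW [:: NW; North; NE; SE; South; SW] k.

Lemma iter_turn_side n k j : (k < 6)%N ->
  iter k turn ((- n%:Z, j%:Z), D60) = side_edge n (side_at k) j.
Proof.
by move: k => [|[|[|[|[|[|k]]]]]] // _ /=; congr ((_, _), _); lia.
Qed.

Lemma has_boundaryP n (w : side -> n.-tuple bool) (P : labelling (hexagon n)) :
  reflect (forall k, (k < 6)%N ->
      map (total_label P \o iter k turn) (left_side n) = word (w (side_at k)))
    (has_boundary w P).
Proof.
have step k : (k < 6)%N ->
    (map (total_label P \o iter k turn) (left_side n) == word (w (side_at k)))
    = [forall j : 'I_n, edge_label P (side_edge n (side_at k) j)
         == Some (label_of_bool (tnth (w (side_at k)) j))].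
  move=> k6; apply/eqP/forallP => [eqm j|eqs].
    rewrite edge_label_total ?side_edge_in // -iter_turn_side //.
    have := congr1 (fun s => nth L0 s j) eqm.
    rewrite /left_side /rising -map_comp (nth_map 0%N) ?size_iota // nth_iota //.
    by rewrite nth_word (tnth_nth false) add0n /= => ->.
  apply: (@eq_from_nth _ L0).
    by rewrite !size_map size_iota size_tuple.
  rewrite !size_map size_iota => j ltj; have /eqP := eqs (Ordinal ltj).
  rewrite edge_label_total ?(side_edge_in (side_at k) (Ordinal ltj)) // -iter_turn_side //.
  rewrite /left_side /rising -map_comp (nth_map 0%N) ?size_iota // nth_iota //.
  by rewrite nth_word (tnth_nth false) add0n /= => -[->].
apply: (iffP forallP) => [bd k k6|bd s]; first by apply/eqP; rewrite step.
have [k k6 ->] : exists2 k, (k < 6)%N & s = side_at k.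
  by case: s; [exists 5|exists 0%N|exists 1%N|exists 2|exists 3|exists 4].
by rewrite -step // bd.
Qed.

Lemma hex_puzzlesE n (w : side -> n.-tuple bool) (P : labelling (hexagon n)) :
  (P \in hex_puzzles w)%:R
  = \prod_(k <- iota 0 6) side_triangle_ok n (w (side_at k)) (total_label P \o iter k turn).
Proof.
rewrite inE /side_triangle_ok.
under eq_bigr do rewrite -natrM mulnb.
transitivity ((all (fun k => (map (total_label P \o iter k turn) (left_side n)
    == word (w (side_at k))) && triangle_ok (total_label P \o iter k turn) n) (iota 0 6))%:R : int).
  congr (nat_of_bool _)%:R; apply/andP/allP.
    move=> [/all_pieces_allowedP/hexagon_okP ok /has_boundaryP bd] k.
    by rewrite mem_iota => k6; rewrite bd // eqxx ok.
  move=> ok; split.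
    apply/all_pieces_allowedP/hexagon_okP => k k6.
    by have := ok k; rewrite mem_iota k6 => /(_ isT)/andP[].
  apply/has_boundaryP => k k6.
  by have := ok k; rewrite mem_iota k6 => /(_ isT)/andP[/eqP].
elim: (iota 0 6) => [|k ks IH]; first by rewrite big_nil.
by rewrite big_cons -IH -natrM mulnb.
Qed.

(** Contains every edge that [side_triangle_ok] reads, including both bounding spokes; the [D120]
    edges with $x + y = 0$ form the right one. *)
Definition closed_sector n e : bool :=
  let: ((x, y), d) := e in
  if d is D120 then [&& - n%:Z + 1 <= x, 0 <= y & x + y <= 0]
  else [&& - n%:Z <= x, 0 <= y & x + y <= -1].

Lemma side_triangle_ok_depends n w :
  depends_on (closed_sector n) (side_triangle_ok n w).
Proof.
move=> L1 L2 eqL; rewrite /side_triangle_ok.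
have -> : map L1 (left_side n) = map L2 (left_side n).
  apply/eq_in_map => -[[x y] d]; rewrite mem_rising => /and4P[/= /eqP-> /eqP-> y0 yn].
  by apply: eqL => /=; lia.
have eq_tri t : in_sector n t -> tri_ok L1 t = tri_ok L2 t.
  case: t => [[] [x y]]; rewrite /in_sector /tri_ok /up_ok /down_ok /= => sec;
    by rewrite !eqL //=; lia.
congr (_ * (nat_of_bool _)%:R).
by apply/triangle_okP/triangle_okP => ok t sec; rewrite ?eq_tri ?ok // -eq_tri ?ok.
Qed.

(** * Spokes and sector interiors *)

Definition owned_edges n : seq edge := left_side n ++ inner_edges n.

(* The NE side is left out, being the bottom side of the next sector. *)
Definition half_open_sector n e : bool :=
  let: ((x, y), d) := e in
  [&& (if d is D120 then - n%:Z + 1 <= x else - n%:Z <= x), 0 <= y & x + y <= -1].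

Lemma mem_owned n e : (e \in owned_edges n) =
  half_open_sector n e && ~~ ((e.2 == D0) && (e.1.2 == 0)).
Proof.
case: e => [[x y] d]; rewrite mem_cat mem_rising mem_inner_edges /half_open_sector /=.
by case: d; rewrite ?eqxx ?dir_eqE ?andbF ?andbT /=; lia.
Qed.

Lemma mem_bottom n e : (e \in bottom_side n) =
  half_open_sector n e && ((e.2 == D0) && (e.1.2 == 0)).
Proof.
case: e => [[x y] d]; rewrite mem_bottom_side /half_open_sector /=.
by case: d; rewrite ?eqxx ?dir_eqE ?andbF ?andbT /=; lia.
Qed.

Lemma uniq_owned n : uniq (owned_edges n).
Proof.
rewrite cat_uniq uniq_rising uniq_inner_edges andbT /=.
apply/hasPn => -[[x y] d]; rewrite mem_inner_edges mem_rising /=.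
by case: d; rewrite ?eqxx ?dir_eqE /=; lia.
Qed.

Lemma sector_disjoint n j k e : (j < 6)%N -> (k < 6)%N ->
  half_open_sector n (iter (6 - j) turn e) ->
  half_open_sector n (iter (6 - k) turn e) -> j = k.
Proof.
case: e => [[x y] d].
move: j k => [|[|[|[|[|[|j]]]]]] [|[|[|[|[|[|k]]]]]] // _ _; case: d => /=; lia.
Qed.

(** Distinct sectors share only edges of spokes, and no sector owns these; this is the independence
    hypothesis of [label_sum_prod]. *)
Lemma owned_disjoint n j k e : (j < 6)%N -> (k < 6)%N -> j != k ->
  iter (6 - j) turn e \in owned_edges n -> ~~ closed_sector n (iter (6 - k) turn e).
Proof.
rewrite mem_owned; case: e => [[x y] d].
move: j k => [|[|[|[|[|[|j]]]]]] [|[|[|[|[|[|k]]]]]] // _ _ _; case: d => /=;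
  rewrite ?eqxx ?dir_eqE /=; lia.
Qed.

Lemma uniq_flatten (T K : eqType) (E : K -> seq T) (ks : seq K) :
  uniq ks -> (forall k, uniq (E k)) ->
  (forall (j k : K) (e : T), j \in ks -> k \in ks -> e \in E j -> e \in E k -> j = k) ->
  uniq (flatten (map E ks)).
Proof.
move=> + uE; elim: ks => //= k ks IH /andP[nk uks] disj.
rewrite cat_uniq uE IH ?andbT //=; last first.
  by move=> i j e iks jks; apply: disj; rewrite inE ?iks ?jks orbT.
apply/hasPn => e /flatten_mapP[j jks ej]; apply/negP => ek.
by move: nk; rewrite (disj k j e) ?jks // ?inE ?eqxx ?jks ?orbT.
Qed.

Definition spokes n : seq edge :=
  flatten [seq map (iter k turn) (bottom_side n) | k <- iota 0 6].

Definition sector_interiors n : seq edge :=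
  flatten [seq map (iter k turn) (owned_edges n) | k <- iota 0 6].

Lemma mem_turn_flatten n S e :
  reflect (exists2 k, (k < 6)%N & iter (6 - k) turn e \in S)
    (e \in flatten [seq map (iter k turn) S | k <- iota 0 6]).
Proof.
apply: (iffP flatten_mapP) => [[k]|[k k6 mem]].
  by rewrite mem_iota => k6; rewrite mem_iter_turn ?(ltnW k6) //; exists k.
by exists k; rewrite ?mem_iota // mem_iter_turn // ltnW.
Qed.

Lemma uniq_turn_flatten n S : uniq S -> {in S, forall e, half_open_sector n e} ->
  uniq (flatten [seq map (iter k turn) S | k <- iota 0 6]).
Proof.
move=> uS subS; apply: uniq_flatten (iota_uniq _ _) _ _.
  by move=> k; rewrite map_inj_uniq //; apply: iter_turn_inj.
move=> j k e; rewrite !mem_iota => j6 k6; rewrite !mem_iter_turn ?(ltnW j6) ?(ltnW k6) //.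
move=> /subS ej /subS ek; exact: sector_disjoint ej ek.
Qed.

Lemma uniq_spokes n : uniq (spokes n).
Proof.
by apply: (@uniq_turn_flatten n) (uniq_bottom_side n) _ => e; rewrite mem_bottom => /andP[].
Qed.

Lemma uniq_hexagon_edges n : uniq (spokes n ++ sector_interiors n).
Proof.
rewrite cat_uniq uniq_spokes /=; apply/andP; split; last first.
  by apply: (@uniq_turn_flatten n) (uniq_owned n) _ => e; rewrite mem_owned => /andP[].
apply/hasPn => e /(mem_turn_flatten n)[k k6]; rewrite mem_owned => /andP[hk nk].
apply/negP => /(mem_turn_flatten n)[j j6]; rewrite mem_bottom => /andP[hj bj].
by move: nk; rewrite -(sector_disjoint j6 k6 hj hk) bj.
Qed.

Lemma mem_hexagon_edges n : spokes n ++ sector_interiors n =i edges (hexagon n).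
Proof.
move=> e; apply/idP/idP.
  have mem k : (k < 6)%N -> half_open_sector n (iter (6 - k) turn e) -> e \in edges (hexagon n).
    case: e => [[x y] d]; rewrite mem_edges_hexagon.
    by move: k => [|[|[|[|[|[|k]]]]]] // _; case: d => /=; lia.
  rewrite mem_cat => /orP[] /(mem_turn_flatten n)[k k6].
    by rewrite mem_bottom => /andP[/mem->].
  by rewrite mem_owned => /andP[/mem->].
move=> hex; suff [k k6 hk] : exists2 k, (k < 6)%N & half_open_sector n (iter (6 - k) turn e).
  rewrite mem_cat; apply/orP.
  have [bk|nk] := boolP (((iter (6 - k) turn e).2 == D0) && ((iter (6 - k) turn e).1.2 == 0)).
    by left; apply/(mem_turn_flatten n); exists k => //; rewrite mem_bottom hk.
  by right; apply/(mem_turn_flatten n); exists k => //; rewrite mem_owned hk.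
have : [|| half_open_sector n (iter 6 turn e), half_open_sector n (iter 5 turn e),
   half_open_sector n (iter 4 turn e), half_open_sector n (iter 3 turn e),
   half_open_sector n (iter 2 turn e) | half_open_sector n (iter 1 turn e)].
  by move: hex; case: e => [[x y] []]; rewrite mem_edges_hexagon /half_open_sector /=; lia.
by move=> /or4P[?|?|?|/or3P[?|?|?]];
  [exists 0%N|exists 1%N|exists 2%N|exists 3%N|exists 4%N|exists 5%N].
Qed.

Lemma turn_bottom_side n : map turn (bottom_side n) = right_side n.
Proof.
elim: n => //= n ->; congr (_ :: _).
by congr ((_, _), _); lia.
Qed.

(** Spoke [k] is the bottom side of sector [k], and spoke [k + 1] modulo 6 is its right side. *)
Definition sector_weight n (w : side -> n.-tuple bool) (ts : seq (seq label)) : int :=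
  \prod_(k <- iota 0 6)
    triangle_puzzles n (word (w (side_at k))) (nth [::] ts (k.+1 %% 6)) (nth [::] ts k).

Lemma hex_puzzles_word_sum n (w : side -> n.-tuple bool) :
  (#|hex_puzzles w|)%:R = word_sum n 6 (sector_weight w).
Proof.
pose Phi k L := side_triangle_ok n (w (side_at k)) (L \o iter k turn).
transitivity (\sum_(P : labelling (hexagon n)) \prod_(k <- iota 0 6) Phi k (total_label P)).
  rewrite -sum1_card natr_sum [LHS]big_mkcond; apply: eq_bigr => P _.
  by rewrite -hex_puzzlesE; case: (P \in _).
rewrite (sum_labelling (E := spokes n ++ sector_interiors n)
  (Phi := fun L => \prod_(k <- iota 0 6) Phi k L)); last 3 first.
- move=> L1 L2 eqL; apply: eq_bigr => k _; apply: side_triangle_ok_depends => e _.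
  exact: eqL.
- exact: uniq_hexagon_edges.
- exact: mem_hexagon_edges.
rewrite label_sum_cat.
transitivity (label_sum (spokes n) (fun=> L0) (fun L =>
  sector_weight w [seq map L E | E <- [seq map (iter k turn) (bottom_side n) | k <- iota 0 6]])).
  apply: eq_label_sum => L _.
  rewrite (label_sum_prod (D := fun k e => closed_sector n (iter (6 - k) turn e))); first last.
  - move=> j k; rewrite !mem_iota => j6 k6 ne e.
    by rewrite mem_iter_turn ?(ltnW j6) //; apply: owned_disjoint.
  - move=> k; rewrite mem_iota => k6 L1 L2 eqL; apply: side_triangle_ok_depends => e De /=.
    by apply: eqL; rewrite -iterD subnK ?turn6 // ltnW.
  - exact: iota_uniq.
  rewrite big_seq [RHS]big_seq; apply: eq_bigr => k; rewrite mem_iota => k6.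
  rewrite (label_sum_image (r := iter k turn)); last 2 first.
  - exact: iter_turn_inj.
  - by move=> L1 L2 eqL; apply: side_triangle_ok_depends => e _; apply: eqL.
  rewrite side_triangle_sum; congr triangle_puzzles.
    rewrite (nth_map [::]) ?size_map ?size_iota ?ltn_pmod //.
    rewrite (nth_map 0%N) ?size_iota ?ltn_pmod // nth_iota ?ltn_pmod // add0n.
    rewrite -turn_bottom_side -!map_comp; apply: eq_map => e /=; congr (L _).
    (* The sixth sector closes the cycle: its right side is spoke 0. *)
    rewrite -iterSr; have [->|k5] := eqVneq k 5%N; first by rewrite turn6.
    by rewrite modn_small //; lia.
  rewrite (nth_map [::]) ?size_map ?size_iota //.
  by rewrite (nth_map 0%N) ?size_iota // nth_iota // add0n -map_comp.
rewrite (label_sum_words (n := n)) ?size_map //; first exact: uniq_spokes.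
by apply/allP => _ /mapP[k _ ->]; rewrite size_map size_bottom_side.
Qed.

End Geometry.

(** * The trace formula *)

Fixpoint bit_sum (R : comNzRingType) n k (F : seq (seq label) -> R) : R :=
  if k is k'.+1 then
    \sum_(t : n.-tuple bool) bit_sum n k' (fun ts => F (word t :: ts))
  else F [::].

Lemma word_sum0 (R : comNzRingType) n k (F : seq (seq label) -> R) :
  (forall ts, size ts = k -> all (fun t => size t == n) ts -> F ts = 0) ->
  word_sum n k F = 0.
Proof.
elim: k F => [|k IH] F F0 /=; first exact: F0.
apply: big1 => t _; apply: IH => ts szts allts; apply: F0; first by rewrite /= szts.
by rewrite /= size_tuple eqxx.
Qed.

Lemma word_sum_bits (R : comNzRingType) n k (F : seq (seq label) -> R) :
  (forall ts, size ts = k -> all (fun t => size t == n) ts ->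
     F ts != 0 -> all (fun t => L10 \notin t) ts) ->
  word_sum n k F = bit_sum n k F.
Proof.
elim: k F => [|k IH] F F0 //=.
have tailP (t : n.-tuple label) ts : size ts = k -> all (fun t => size t == n) ts ->
    F (tval t :: ts) != 0 -> (L10 \notin t) && all (fun t => L10 \notin t) ts.
  move=> szts allts nz; apply: (F0 (tval t :: ts)) => //; first by rewrite /= szts.
  by rewrite /= size_tuple eqxx.
rewrite (bigID (fun t : n.-tuple label => L10 \notin t)) /= [X in _ + X]big1 ?addr0.
  pose bits (t : n.-tuple label) := [tuple of map (pred1 L1) t].
  rewrite (reindex_onto (fun t : n.-tuple bool => [tuple of word t]) bits) /=.
    apply: eq_big => [t|t _].
      have -> /= : bits [tuple of word t] = t.
        by apply: val_inj; rewrite /= -map_comp map_id_in // => -[].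
      by rewrite eqxx andbT; apply/mapP => -[[]].
    apply: IH => ts szts allts nz.
    by have /andP[] := tailP [tuple of word t] ts szts allts nz.
  move=> t nt; apply: val_inj; rewrite /= -map_comp map_id_in // => l lt.
  by case: l lt nt => // ->.
move=> t tL; apply: word_sum0 => ts szts allts; apply: contraNeq tL => nz.
by have /andP[] := tailP t ts szts allts nz.
Qed.

(** As the sides of the hexagon carry no 10, conservation in sector [k] says that spoke [k] has as
    many 1 as spoke [k + 1] has 1 and 10 together. Adding these equalities around the centre, the
    numbers of 10 sum to zero. *)
Lemma sector_weight_bits n (w : side -> n.-tuple bool) ts :
  size ts = 6%N -> all (fun t => size t == n) ts ->
  sector_weight w ts != 0 -> all (fun t => L10 \notin t) ts.
Proof.
case: ts => [|t0 [|t1 [|t2 [|t3 [|t4 [|t5 []]]]]]] //= _.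
move=> /and5P[/eqP s0 /eqP s1 /eqP s2 /eqP s3 /and3P[/eqP s4 /eqP s5 _]].
rewrite /sector_weight !big_cons big_nil /= !mulf_eq0 !negb_or.
move=> /and5P[z0 z1 z2 z3 /and3P[z4 z5 _]].
have cons (v : n.-tuple bool) r b : size r = n -> size b = n ->
    triangle_puzzles n (word v) r b != 0 ->
    (count_mem L1 b = count_mem L1 r + count_mem L10 r)%N.
  move=> szr szb /triangle_conservation.
  rewrite !size_map size_tuple size_nseq szr szb count_L10_word => /(_ erefl erefl erefl).
  rewrite add0n => ->; rewrite -count_predUI addnC.
  rewrite [X in (X + _)%N](_ : _ = 0)%N ?add0n; first by apply: eq_count; case.
  by rewrite -(count_pred0 r); apply: eq_count; case.
move: (cons _ _ _ s1 s0 z0) (cons _ _ _ s2 s1 z1) (cons _ _ _ s3 s2 z2)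
  (cons _ _ _ s4 s3 z3) (cons _ _ _ s5 s4 z4) (cons _ _ _ s0 s5 z5) => {cons}.
have no10 t : (L10 \notin t) = (count_mem L10 t == 0)%N.
  by rewrite -has_pred1 has_count lt0n negbK.
rewrite !no10; lia.
Qed.

(** * Products of commuting operators *)

Section Chains.
Variables (T : finType) (R : comNzRingType).
Implicit Types A B C : T -> T -> R.

Definition compose A B x y : R := \sum_z A x z * B z y.

Definition chain (As : seq (T -> T -> R)) : T -> T -> R :=
  foldr compose (fun x y => (x == y)%:R) As.

Lemma compose_left_commute A B C x y :
  (forall x y, compose A B x y = compose B A x y) ->
  compose A (compose B C) x y = compose B (compose A C) x y.
Proof.
have assoc A1 A2 : compose A1 (compose A2 C) x y = \sum_z compose A1 A2 x z * C z y.
  rewrite /compose; under eq_bigr do rewrite mulr_sumr.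
  rewrite exchange_big; apply: eq_bigr => z _; rewrite mulr_suml.
  by apply: eq_bigr => u _; rewrite mulrA.
by move=> comm; rewrite !assoc; apply: eq_bigr => z _; rewrite comm.
Qed.

Lemma chain_perm (K : eqType) (M : K -> T -> T -> R) s1 s2 x y :
  (forall j k x y, compose (M j) (M k) x y = compose (M k) (M j) x y) ->
  perm_eq s1 s2 -> chain (map M s1) x y = chain (map M s2) x y.
Proof.
move=> comm.
(* Successive commutations bring an inner factor to the front. *)
have front k p q x' y' : chain (map M (p ++ k :: q)) x' y' = chain (map M (k :: p ++ q)) x' y'.
  elim: p x' => //= j p IH x'; rewrite -compose_left_commute //.
  by apply: eq_bigr => z _; rewrite IH.
elim: s1 s2 x => [|k s1 IH] s2 x; first by rewrite perm_sym => /perm_nilP ->.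
move=> perm12; have : k \in s2 by rewrite -(perm_mem perm12) mem_head.
move=> /splitPr def2; case: def2 perm12 => p q.
rewrite perm_sym -cat1s perm_catCA perm_sym perm_cons => perm1.
by rewrite front /=; apply: eq_bigr => z _; rewrite (IH _ z perm1).
Qed.
End Chains.

Definition side_order : seq side := [:: NW; North; NE; SE; South; SW].

(** This is $M_u$, with rows indexed by the bottom side and columns by the NE side, so that
    composition glues consecutive sectors along a spoke. *)
Definition side_operator n (u x y : n.-tuple bool) : int :=
  triangle_puzzles n (word u) (word y) (word x).

Lemma hex_puzzles_trace n (w : side -> n.-tuple bool) :
  (#|hex_puzzles w|)%:R
  = \sum_x chain [seq side_operator (w s) | s <- side_order] x x :> int.
Proof.
rewrite hex_puzzles_word_sum word_sum_bits; last exact: sector_weight_bits.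
rewrite /= /compose.
apply: eq_bigr => t0 _; apply: eq_bigr => t1 _.
rewrite mulr_sumr; apply: eq_bigr => t2 _.
rewrite !mulr_sumr; apply: eq_bigr => t3 _.
rewrite !mulr_sumr; apply: eq_bigr => t4 _.
rewrite !mulr_sumr; apply: eq_bigr => t5 _.
(* The identity that ends the chain forces the last index to be the first spoke [t0]. *)
rewrite (bigD1 t0) //= eqxx big1 ?addr0.
  by rewrite /sector_weight !big_cons big_nil.
by move=> z /negbTE->; rewrite mulr0.
Qed.

Theorem theorem11 (a a1 : nat) (ha : (a1 <= a)%N)
    (alpha beta gamma delta epsilon zeta : a.-tuple bool)
    (halpha : alpha \in words a a1) (hbeta : beta \in words a a1)
    (hgamma : gamma \in words a a1) (hdelta : delta \in words a a1)
    (hepsilon : epsilon \in words a a1) (hzeta : zeta \in words a a1)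
    (f : {perm side}) :
  let w := sides alpha beta gamma delta epsilon zeta in
  Hex alpha beta gamma delta epsilon zeta =
  Hex (w (f SW)) (w (f NW)) (w (f North)) (w (f NE)) (w (f SE)) (w (f South)).
Proof.
move=> w; apply/eqP; rewrite -(eqr_nat int) /Hex !hex_puzzles_trace; apply/eqP.
apply: eq_bigr => x _.
(* Permuting the boundary labels by [f] reorders the list of the six operators. *)
have perm_f : perm_eq side_order (map f side_order).
  have side_uniq : uniq side_order.
    by rewrite /side_order /= !inE !negb_or; do ![apply/andP; split] => //; apply/eqP.
  have mem_side s : s \in side_order by rewrite /side_order; case: s; rewrite !inE eqxx ?orbT.
  apply: uniq_perm => //; first by rewrite map_inj_uniq //; apply: perm_inj.
  by move=> s; rewrite -[s](permKV f) mem_map ?mem_side //; apply: perm_inj.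
rewrite (chain_perm _ _ _ perm_f); first by rewrite -map_comp.
by move=> j k y z; apply: triangle_commute.
Qed.
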